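(* Let $G$ be an infinite locally finite group which is planar. Then $G$ is abelian.
   Context: For a group $G$, the subgroup graph $\mathcal{L}(G)$ is the graph whose vertices are all subgroups of $G$, two subgroups $H,K$ being adjacent if one of them is a maximal subgroup of the other. $G$ is planar if $\mathcal{L}(G)$ is a planar graph. A group is locally finite if every finitely generated subgroup is finite. *)

(* Defs.v *)
From Stdlib Require Import Reals List.
Open Scope R_scope.

Record Group := {
  carrier :> Type;
  gmul : carrier -> carrier -> carrier;
  gone : carrier;
  ginv : carrier -> carrier;
  gmulA : forall x y z, gmul x (gmul y z) = gmul (gmul x y) z;
  gmul1l : forall x, gmul gone x = x;
  gmulVl : forall x, gmul (ginv x) x = gone
}.

Section GroupDefs.
Variable G : Group.

Definition same_set (A B : G -> Prop) : Prop := forall x, A x <-> B x.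
Definition subset (A B : G -> Prop) : Prop := forall x, A x -> B x.
Definition proper_subset (A B : G -> Prop) : Prop :=
  subset A B /\ exists x, B x /\ ~ A x.

Definition is_subgroup (H : G -> Prop) : Prop :=
  H (gone G) /\
  (forall x y, H x -> H y -> H (gmul G x y)) /\
  (forall x, H x -> H (ginv G x)).

Definition maximal_subgroup_of (H K : G -> Prop) : Prop :=
  is_subgroup H /\ is_subgroup K /\ proper_subset H K /\
  forall L, is_subgroup L -> subset H L -> subset L K ->
    same_set L H \/ same_set L K.

Definition subgroup_adj (H K : G -> Prop) : Prop :=
  maximal_subgroup_of H K \/ maximal_subgroup_of K H.

Definition finite_subset (A : G -> Prop) : Prop :=
  exists l : list G, forall x, A x -> In x l.

Definition generated (S : G -> Prop) : G -> Prop :=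
  fun x => forall H, is_subgroup H -> subset S H -> H x.

Definition locally_finite : Prop :=
  forall l : list G, finite_subset (generated (fun x => In x l)).

Definition infinite_group : Prop := ~ finite_subset (fun _ => True).

Definition abelian_group : Prop := forall x y : G, gmul G x y = gmul G y x.

End GroupDefs.

Definition cont01 (g : R -> R) : Prop :=
  forall t, 0 <= t <= 1 -> forall eps, eps > 0 ->
    exists d, d > 0 /\ forall s, 0 <= s <= 1 -> Rabs (s - t) < d ->
      Rabs (g s - g t) < eps.

Definition arc_from_to (a : R -> R * R) (p q : R * R) : Prop :=
  cont01 (fun t => fst (a t)) /\ cont01 (fun t => snd (a t)) /\
  (forall s t, 0 <= s <= 1 -> 0 <= t <= 1 -> a s = a t -> s = t) /\
  a 0 = p /\ a 1 = q.

(** A graph is given by a vertex predicate [isV] on a type [V], an equivalence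
    [eqv] saying when two representatives denote the same vertex, and an
    adjacency relation [adj] (symmetric).  It is planar if it has a drawing in
    the plane: distinct vertices go to distinct points, every edge is drawn as
    an arc between its end points whose interior avoids all vertex points, and
    interiors of arcs of distinct edges are disjoint. *)
Definition planar_graph (V : Type) (isV : V -> Prop) (eqv : V -> V -> Prop)
  (adj : V -> V -> Prop) : Prop :=
  exists (pos : V -> R * R) (arc : V -> V -> R -> R * R),
    (forall u v, isV u -> isV v -> (pos u = pos v <-> eqv u v)) /\
    (forall u v, isV u -> isV v -> adj u v -> arc_from_to (arc u v) (pos u) (pos v)) /\
    (forall u v w t, isV u -> isV v -> isV w -> adj u v -> 0 < t < 1 ->
       arc u v t <> pos w) /\
    (forall u v u' v' s t, isV u -> isV v -> isV u' -> isV v' ->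
       adj u v -> adj u' v' ->
       ~ (eqv u u' /\ eqv v v') -> ~ (eqv u v' /\ eqv v u') ->
       0 < s < 1 -> 0 < t < 1 -> arc u v s <> arc u' v' t).

Definition planar_group (G : Group) : Prop :=
  planar_graph (G -> Prop) (@is_subgroup G) (@same_set G) (@subgroup_adj G).

(* Main.v *)
Require Import Defs.
From Stdlib Require Import Reals Lra Lia List Bool Btauto ClassicalEpsilon.
From Coquelicot Require Import Compactness.

(* Nonplanarity is always detected by a K_{3,3} minor.  Modulo 2, the crossings
   of the positive x-axis by the vectors joining two disjoint arcs satisfy one
   relation per pair of disjoint edges, and these relations are inconsistent
   for K_{3,3}; this handles arbitrary continuous drawings.

   In a group with planar subgroup graph, the following configurations are
   impossible: three maximal subgroups of [W], each contained in a subgroup not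
   comparable with [W]; and three covers of [W <> 1], none of them having [W]
   as its only maximal subgroup.  Hence a finite nonabelian subgroup [E]
   contains its centraliser, a noncyclic [p]-subgroup normalises no nontrivial
   [p']-subgroup, and a noncyclic Sylow subgroup of a finite subgroup is normal
   (otherwise the Sylow normalisers in a minimal counterexample are either
   arranged in a K_{3,3} or Frobenius complements).

   Now fix [E] nonabelian and let [F] be a finite subgroup containing [E].
   If [F] has a noncyclic Sylow [p]-subgroup [P], then either [P] is small, and
   so is [F] because ['C_F(P)] is a [p]-group; or ['Phi(P) <> 1], so that [F = P],
   and the large cyclic group ['Phi(P)] is almost central, hence almost inside
   [E].  If all Sylow subgroups of [F] are cyclic, then [F] is solvable, has at
   most three prime divisors, and the Frattini subgroups of its Sylow subgroups
   are central, hence inside [E].  In both cases [#|F|] is bounded, which is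
   impossible in an infinite locally finite group. *)

Set Implicit Arguments.
Unset Strict Implicit.
Unset Printing Implicit Defensive.

Local Open Scope R_scope.

(** * Drawings of graphs with a K_{3,3} minor *)

(** The arcs are merely continuous and may meet the x-axis infinitely often, so crossings are
    counted along subdivisions of mesh 1/(N+1). The parities themselves are not shown to stabilise
    with [N]: finitely many relations between them hold for one common large [N], and their
    inconsistency is Boolean algebra. Infinite planar abelian groups exist (the quasicyclic groups),
    so planarity alone bounds no finite subgroup. The nonabelian [E] is the anchor: what is central
    in [F] centralises [E], hence lies in [E], whose order stays fixed while [F] grows. The aim is
    therefore a central subgroup of bounded index in [F], except where the order of a Sylow subgroup
    already bounds [F]. *)

Definition psub (u v : R * R) : R * R := (fst u - fst v, snd u - snd v).

Definition rpos (x : R) : bool := if Rlt_dec 0 x then true else false.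

(* Half-open upper half plane: exactly one of [v] and [-v] is upper when [v <> 0]. *)
Definition upper (v : R * R) : bool :=
  if Rlt_dec 0 (snd v) then true
  else if Rlt_dec (snd v) 0 then false else rpos (fst v).

(* Parity of the crossings of the positive x-axis by a short segment from [u]
   to [v]; "short" means that the two points share the sign of a coordinate. *)
Definition crossing (u v : R * R) : bool :=
  xorb (upper u) (upper v) && rpos (fst u).

Definition same_sign (x y z t : R) : Prop :=
  (0 < x /\ 0 < y /\ 0 < z /\ 0 < t) \/ (x < 0 /\ y < 0 /\ z < 0 /\ t < 0).

(** The four points lie in a common open half-plane bounded by a coordinate axis, so a polygon
    through them cannot surround the origin. Repeated arguments express the same for two points. *)
Definition near4 (p q r s : R * R) : Prop :=
  same_sign (fst p) (fst q) (fst r) (fst s) \/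
  same_sign (snd p) (snd q) (snd r) (snd s).

Lemma rpos_true x : 0 < x -> rpos x = true.
Proof. intros H; unfold rpos; destruct (Rlt_dec 0 x); [reflexivity | contradiction]. Qed.

Lemma rpos_false x : x <= 0 -> rpos x = false.
Proof. intros H; unfold rpos; destruct (Rlt_dec 0 x); [lra | reflexivity]. Qed.

Lemma upper_true v : 0 < snd v -> upper v = true.
Proof. intros H; unfold upper; destruct (Rlt_dec 0 (snd v)); [reflexivity | contradiction]. Qed.

Lemma upper_false v : snd v < 0 -> upper v = false.
Proof.
  intros H; unfold upper; destruct (Rlt_dec 0 (snd v)); [lra|].
  destruct (Rlt_dec (snd v) 0); [reflexivity | contradiction].
Qed.

Lemma upper_psub u v : u <> v -> upper (psub u v) = negb (upper (psub v u)).
Proof.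
  destruct u as [x y], v as [x' y']; intros H.
  assert (x <> x' \/ y <> y') by
    (destruct (Req_dec x x'); [right; intros ->; apply H; congruence | now left]).
  unfold upper, rpos, psub; simpl.
  repeat (destruct (Rlt_dec _ _); simpl; try reflexivity; try lra).
Qed.

(** In the right half-plane crossings are differences of [upper] and cancel around a closed loop; in
    the left one [rpos] kills them; in the other two cases [upper] is constant. *)
Lemma crossing_near p q r s : near4 p q r s ->
  xorb (xorb (crossing p q) (crossing q s)) (xorb (crossing p r) (crossing r s))
  = false.
Proof.
  unfold near4, same_sign, crossing; intros [[H|H]|[H|H]]; destruct H as (H1 & H2 & H3 & H4).
  - rewrite (rpos_true H1), (rpos_true H2), (rpos_true H3).
    generalize (upper p) (upper q) (upper r) (upper s); intros; btauto.
  - rewrite !rpos_false by lra; rewrite !andb_false_r; reflexivity.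
  - rewrite !upper_true by assumption; reflexivity.
  - rewrite !upper_false by assumption; reflexivity.
Qed.

(** Negation exchanges the two halves of the x-axis, and the crossings of both halves add up to
    those of the whole axis, that is, to the change of [upper]. *)
Lemma crossing_opp p q a b : near4 (psub p q) (psub p q) (psub a b) (psub a b) ->
  crossing (psub p q) (psub a b) =
  xorb (crossing (psub q p) (psub b a))
       (xorb (upper (psub q p)) (upper (psub b a))).
Proof.
  destruct p as [px py], q as [qx qy], a as [ax ay], b as [bx by'].
  unfold near4, same_sign; simpl; intros H.
  assert (E1 : upper (psub (px, py) (qx, qy)) = negb (upper (psub (qx, qy) (px, py)))).
  { apply upper_psub; intros E; injection E; intros -> ->; lra. }
  assert (E2 : upper (psub (ax, ay) (bx, by')) = negb (upper (psub (bx, by') (ax, ay)))).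
  { apply upper_psub; intros E; injection E; intros -> ->; lra. }
  unfold crossing; rewrite E1, E2; clear E1 E2.
  destruct H as [H|H].
  - assert (E : rpos (fst (psub (px, py) (qx, qy))) = negb (rpos (fst (psub (qx, qy) (px, py))))).
    { unfold psub; simpl; destruct H as [H|H].
      - now rewrite rpos_true, rpos_false by lra.
      - now rewrite rpos_false, rpos_true by lra. }
    rewrite E; generalize (upper (psub (qx, qy) (px, py))) (upper (psub (bx, by') (ax, ay)))
      (rpos (fst (psub (qx, qy) (px, py)))); intros [] [] []; reflexivity.
  - assert (E : upper (psub (qx, qy) (px, py)) = upper (psub (bx, by') (ax, ay))).
    { destruct H as [H|H].
      - now rewrite !upper_false by (unfold psub; simpl; lra).
      - now rewrite !upper_true by (unfold psub; simpl; lra). }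
    rewrite E; generalize (upper (psub (bx, by') (ax, ay))); intros []; reflexivity.
Qed.

Lemma xorb_combine x y z w s t :
  t = xorb s (xorb (xorb x y) (xorb z w)) -> x = y /\ z = w -> t = s.
Proof. intros -> [-> ->]; btauto. Qed.

Fixpoint xsum (f : nat -> bool) (n : nat) : bool :=
  match n with O => false | S m => xorb (xsum f m) (f m) end.

Lemma xsum_xorb f g n : xsum (fun i => xorb (f i) (g i)) n = xorb (xsum f n) (xsum g n).
Proof. induction n as [|n IH]; simpl; [reflexivity | rewrite IH; btauto]. Qed.

Lemma xsum_ext f g n : (forall i, (i < n)%nat -> f i = g i) -> xsum f n = xsum g n.
Proof.
  induction n as [|n IH]; simpl; intros H; [reflexivity|].
  rewrite IH by (intros; apply H; lia); rewrite H by lia; reflexivity.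
Qed.

Lemma xsum_telescope h n : xsum (fun i => xorb (h i) (h (S i))) n = xorb (h O) (h n).
Proof. induction n as [|n IH]; simpl; [btauto | rewrite IH; btauto]. Qed.

(** A discrete Stokes formula: in the sum of the cell relations modulo 2 every inner edge occurs
    twice, and only the boundary of the grid remains. *)
Lemma crossing_grid (U : nat -> nat -> R * R) m n :
  (forall i j, (i < m)%nat -> (j < n)%nat ->
     near4 (U i j) (U (S i) j) (U i (S j)) (U (S i) (S j))) ->
  xorb (xorb (xsum (fun j => crossing (U O j) (U O (S j))) n)
             (xsum (fun j => crossing (U m j) (U m (S j))) n))
       (xorb (xsum (fun i => crossing (U i O) (U (S i) O)) m)
             (xsum (fun i => crossing (U i n) (U (S i) n)) m)) = false.
Proof.
  intros H.
  assert (col : forall i, (i < m)%nat ->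
    xorb (xorb (xsum (fun j => crossing (U i j) (U i (S j))) n)
               (xsum (fun j => crossing (U (S i) j) (U (S i) (S j))) n))
         (xorb (crossing (U i O) (U (S i) O)) (crossing (U i n) (U (S i) n))) = false).
  { intros i Hi; rewrite <- xsum_xorb.
    erewrite xsum_ext.
    2:{ intros j Hj; instantiate (1 := fun j =>
          xorb (crossing (U i j) (U (S i) j)) (crossing (U i (S j)) (U (S i) (S j)))).
        generalize (crossing_near (H i j Hi Hj)).
        destruct (crossing (U i j) (U (S i) j)), (crossing (U (S i) j) (U (S i) (S j))),
          (crossing (U i j) (U i (S j))), (crossing (U i (S j)) (U (S i) (S j)));
        simpl; congruence. }
    rewrite (xsum_telescope (fun j => crossing (U i j) (U (S i) j))); btauto. }
  clear H; induction m as [|m IH]; simpl; [btauto|].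
  assert (E := IH (fun i Hi => col i (Nat.lt_lt_succ_r _ _ Hi))).
  assert (F := col m (Nat.lt_succ_diag_r m)).
  revert E F.
  generalize (xsum (fun j => crossing (U O j) (U O (S j))) n)
    (xsum (fun j => crossing (U m j) (U m (S j))) n)
    (xsum (fun j => crossing (U (S m) j) (U (S m) (S j))) n)
    (xsum (fun i => crossing (U i O) (U (S i) O)) m)
    (xsum (fun i => crossing (U i n) (U (S i) n)) m)
    (crossing (U m O) (U (S m) O)) (crossing (U m n) (U (S m) n)).
  intros [] [] [] [] [] [] []; simpl; congruence.
Qed.

(** * Subdivisions and winding parities of disjoint curves *)

Definition eventually_nat (P : nat -> Prop) : Prop :=
  exists N0, forall N, (N0 <= N)%nat -> P N.

Lemma eventually_and P Q :
  eventually_nat P -> eventually_nat Q -> eventually_nat (fun N => P N /\ Q N).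
Proof.
  intros [a Ha] [b Hb]; exists (Nat.max a b); intros N HN.
  split; [apply Ha | apply Hb]; lia.
Qed.

Lemma eventually_mono (P Q : nat -> Prop) :
  (forall N, P N -> Q N) -> eventually_nat P -> eventually_nat Q.
Proof. intros H [a Ha]; exists a; auto. Qed.

(* The [i]-th point of the subdivision of [0,1] into [N+1] steps. *)
Definition node (N i : nat) : R := INR i / INR (S N).

Lemma node_bounds N i : (i <= S N)%nat -> 0 <= node N i <= 1.
Proof.
  intros H; unfold node.
  assert (0 < INR (S N)) by (apply lt_0_INR; lia).
  split; [apply Rmult_le_pos; [apply pos_INR | left; now apply Rinv_0_lt_compat]|].
  apply Rmult_le_reg_r with (INR (S N)); [assumption|].
  unfold Rdiv; rewrite Rmult_assoc, Rinv_l, Rmult_1_r, Rmult_1_l by lra.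
  now apply le_INR.
Qed.

Lemma node0 N : node N 0 = 0.
Proof. unfold node; simpl INR; unfold Rdiv; apply Rmult_0_l. Qed.

Lemma node1 N : node N (S N) = 1.
Proof. unfold node; field; apply not_0_INR; lia. Qed.

Lemma node_step d : 0 < d ->
  eventually_nat (fun N => forall i, node N i <= node N (S i) < node N i + d).
Proof.
  intros Hd; destruct (archimed_cor1 d Hd) as [N0 [H0 H1]].
  exists N0; intros N HN i.
  assert (E : node N (S i) = node N i + / INR (S N)).
  { unfold node; rewrite (S_INR i); field; apply not_0_INR; lia. }
  assert (0 < INR N0) by (apply lt_0_INR; lia).
  assert (INR N0 <= INR (S N)) by (apply le_INR; lia).
  assert (/ INR (S N) <= / INR N0) by (apply Rinv_le_contravar; lra).
  assert (0 < / INR (S N)) by (apply Rinv_0_lt_compat; lra).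
  lra.
Qed.

Definition cont_curve (f : R -> R * R) : Prop :=
  cont01 (fun t => fst (f t)) /\ cont01 (fun t => snd (f t)).

Definition disjoint_curves (f g : R -> R * R) : Prop :=
  forall s t, 0 <= s <= 1 -> 0 <= t <= 1 -> f s <> g t.

(** The factor 2 prepares the compactness argument: a node lies within the radius of some centre,
    and the step to the next node is less than that radius. *)
Lemma cont01_sub_pos f g u v : cont01 f -> cont01 g ->
  0 <= u <= 1 -> 0 <= v <= 1 -> 0 < g v - f u ->
  exists d : posreal, forall s t, 0 <= s <= 1 -> 0 <= t <= 1 ->
    Rabs (s - u) < 2 * d -> Rabs (t - v) < 2 * d -> 0 < g t - f s.
Proof.
  intros Hf Hg Hu Hv H.
  destruct (Hf u Hu ((g v - f u) / 2)) as [d1 [P1 Q1]]; [lra|].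
  destruct (Hg v Hv ((g v - f u) / 2)) as [d2 [P2 Q2]]; [lra|].
  assert (P : 0 < Rmin d1 d2 / 2) by (assert (0 < Rmin d1 d2) by (apply Rmin_pos; lra); lra).
  exists (mkposreal _ P); simpl; intros s t Hs Ht H1 H2.
  assert (M1 := Rmin_l d1 d2); assert (M2 := Rmin_r d1 d2).
  assert (A1 := Q1 s Hs ltac:(lra)); assert (A2 := Q2 t Ht ltac:(lra)).
  apply Rabs_def2 in A1; apply Rabs_def2 in A2; lra.
Qed.

Lemma cont01_opp f : cont01 f -> cont01 (fun t => - f t).
Proof.
  intros H t Ht e He; destruct (H t Ht e He) as [d [P Q]]; exists d; split; [exact P|].
  intros s Hs A; replace (- f s - - f t) with (- (f s - f t)) by ring.
  rewrite Rabs_Ropp; auto.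
Qed.

Lemma curves_local_sign f g u v : cont_curve f -> cont_curve g ->
  disjoint_curves f g -> 0 <= u <= 1 -> 0 <= v <= 1 ->
  exists d : posreal, forall s1 s2 t1 t2,
    0 <= s1 <= 1 -> 0 <= s2 <= 1 -> 0 <= t1 <= 1 -> 0 <= t2 <= 1 ->
    Rabs (s1 - u) < 2 * d -> Rabs (s2 - u) < 2 * d ->
    Rabs (t1 - v) < 2 * d -> Rabs (t2 - v) < 2 * d ->
    near4 (psub (g t1) (f s1)) (psub (g t1) (f s2))
          (psub (g t2) (f s1)) (psub (g t2) (f s2)).
Proof.
  intros [Hf1 Hf2] [Hg1 Hg2] Hd Hu Hv.
  assert (N := Hd u v Hu Hv).
  assert (C : 0 < fst (g v) - fst (f u) \/ 0 < - fst (g v) - - fst (f u) \/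
              0 < snd (g v) - snd (f u) \/ 0 < - snd (g v) - - snd (f u)).
  { destruct (Rtotal_order (fst (g v)) (fst (f u))) as [L|[E|L]]; [lra| |lra].
    destruct (Rtotal_order (snd (g v)) (snd (f u))) as [L|[E'|L]]; [lra| |lra].
    destruct N; destruct (f u), (g v); simpl in *; congruence. }
  unfold near4, same_sign, psub; simpl.
  destruct C as [C|[C|[C|C]]].
  - destruct (cont01_sub_pos Hf1 Hg1 Hu Hv C) as [d D]; exists d; intros.
    left; left; repeat split; apply D; assumption.
  - destruct (cont01_sub_pos (cont01_opp Hf1) (cont01_opp Hg1) Hu Hv C) as [d D].
    exists d; intros s1 s2 t1 t2 ? ? ? ? ? ? ? ?; left; right.
    assert (D11 := D s1 t1); assert (D12 := D s1 t2).
    assert (D21 := D s2 t1); assert (D22 := D s2 t2); simpl in *.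
    repeat split; lra.
  - destruct (cont01_sub_pos Hf2 Hg2 Hu Hv C) as [d D]; exists d; intros.
    right; left; repeat split; apply D; assumption.
  - destruct (cont01_sub_pos (cont01_opp Hf2) (cont01_opp Hg2) Hu Hv C) as [d D].
    exists d; intros s1 s2 t1 t2 ? ? ? ? ? ? ? ?; right; right.
    assert (D11 := D s1 t1); assert (D12 := D s1 t2).
    assert (D21 := D s2 t1); assert (D22 := D s2 t2); simpl in *.
    repeat split; lra.
Qed.

Lemma curves_fine_grid f g : cont_curve f -> cont_curve g -> disjoint_curves f g ->
  eventually_nat (fun N => forall i j, (i < S N)%nat -> (j < S N)%nat ->
    near4 (psub (g (node N j)) (f (node N i))) (psub (g (node N j)) (f (node N (S i))))
          (psub (g (node N (S j))) (f (node N i)))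
          (psub (g (node N (S j))) (f (node N (S i))))).
Proof.
  intros Hf Hg Hd.
  assert (L : forall u v, exists d : posreal, 0 <= u <= 1 -> 0 <= v <= 1 ->
    forall s1 s2 t1 t2,
    0 <= s1 <= 1 -> 0 <= s2 <= 1 -> 0 <= t1 <= 1 -> 0 <= t2 <= 1 ->
    Rabs (s1 - u) < 2 * d -> Rabs (s2 - u) < 2 * d ->
    Rabs (t1 - v) < 2 * d -> Rabs (t2 - v) < 2 * d ->
    near4 (psub (g t1) (f s1)) (psub (g t1) (f s2))
          (psub (g t2) (f s1)) (psub (g t2) (f s2))).
  { intros u v.
    destruct (classic (0 <= u <= 1 /\ 0 <= v <= 1)) as [[Hu Hv]|H].
    - destruct (curves_local_sign Hf Hg Hd Hu Hv) as [d D]; exists d; auto.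
    (* Outside the unit square the radius is a dummy value that makes the gauge [delta] total. *)
    - exists (mkposreal 1 Rlt_0_1); tauto. }
  pose (delta u v := proj1_sig (constructive_indefinite_description _ (L u v))).
  assert (D := fun u v => proj2_sig (constructive_indefinite_description _ (L u v))).
  change (forall u v, 0 <= u <= 1 -> 0 <= v <= 1 -> forall s1 s2 t1 t2,
    0 <= s1 <= 1 -> 0 <= s2 <= 1 -> 0 <= t1 <= 1 -> 0 <= t2 <= 1 ->
    Rabs (s1 - u) < 2 * delta u v -> Rabs (s2 - u) < 2 * delta u v ->
    Rabs (t1 - v) < 2 * delta u v -> Rabs (t2 - v) < 2 * delta u v ->
    near4 (psub (g t1) (f s1)) (psub (g t1) (f s2))
          (psub (g t2) (f s1)) (psub (g t2) (f s2))) in D.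
  destruct (compactness_value_2d 0 1 0 1 delta) as [d Hc].
  destruct (node_step (cond_pos d)) as [N0 HN0].
  exists N0; intros N HN i j Hi Hj.
  assert (Bi : 0 <= node N i <= 1) by (apply node_bounds; lia).
  assert (Bj : 0 <= node N j <= 1) by (apply node_bounds; lia).
  destruct (NNPP _ (Hc _ _ Bi Bj)) as (u & v & Hu & Hv & Du & Dv & Dd).
  assert (Si := HN0 N HN i); assert (Sj := HN0 N HN j).
  apply Rabs_def2 in Du; apply Rabs_def2 in Dv.
  apply (D u v Hu Hv); try (apply node_bounds; lia); apply Rabs_def1; lra.
Qed.

Definition winding (N : nat) (p : R * R) (f : R -> R * R) : bool :=
  xsum (fun i => crossing (psub (f (node N i)) p) (psub (f (node N (S i))) p)) (S N).

(** The grid formula is applied to [g t - f s] on the unit square, which omits the origin. Two sides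
    of the square give the parities of [g] about the ends of [f]. On the other two, [crossing_opp]
    reverses the vectors, which yields the parities of [f] about the ends of [g] and the half-plane
    terms. *)
Lemma winding_disjoint f g : cont_curve f -> cont_curve g -> disjoint_curves f g ->
  eventually_nat (fun N =>
    xorb (xorb (winding N (f 0) g) (winding N (f 1) g))
         (xorb (winding N (g 0) f) (winding N (g 1) f)) =
    xorb (xorb (upper (psub (f 0) (g 0))) (upper (psub (f 1) (g 0))))
         (xorb (upper (psub (f 0) (g 1))) (upper (psub (f 1) (g 1))))).
Proof.
  intros Hf Hg Hd.
  apply (eventually_mono (P := fun N => forall i j, (i < S N)%nat -> (j < S N)%nat ->
    near4 (psub (g (node N j)) (f (node N i))) (psub (g (node N j)) (f (node N (S i))))
          (psub (g (node N (S j))) (f (node N i)))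
          (psub (g (node N (S j))) (f (node N (S i)))))); [|now apply curves_fine_grid].
  intros N H.
  pose (U i j := psub (g (node N j)) (f (node N i))).
  assert (E := crossing_grid (U := U) H).
  assert (side : forall j, (j <= S N)%nat ->
    xsum (fun i => crossing (U i j) (U (S i) j)) (S N) =
    xorb (winding N (g (node N j)) f)
      (xorb (upper (psub (f (node N 0)) (g (node N j))))
            (upper (psub (f (node N (S N))) (g (node N j)))))).
  { intros j Hj; unfold winding.
    rewrite <- (xsum_telescope (fun i => upper (psub (f (node N i)) (g (node N j))))).
    rewrite <- xsum_xorb; apply xsum_ext; intros i Hi; unfold U.
    apply crossing_opp.
    destruct j as [|j].
    - assert (K := H i O Hi ltac:(lia)); unfold near4, same_sign in *; simpl in *; intuition lra.
    - assert (K := H i j Hi ltac:(lia)); unfold near4, same_sign in *; simpl in *; intuition lra. }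
  assert (S0 := side O ltac:(lia)); assert (S1 := side (S N) ltac:(lia)).
  rewrite S0, S1 in E; clear S0 S1 side.
  change (xsum (fun j => crossing (U O j) (U O (S j))) (S N)) with (winding N (f (node N 0)) g) in E.
  change (xsum (fun j => crossing (U (S N) j) (U (S N) (S j))) (S N))
    with (winding N (f (node N (S N))) g) in E.
  rewrite !node0, !node1 in E.
  revert E.
  generalize (winding N (f 0) g) (winding N (f 1) g) (winding N (g 0) f) (winding N (g 1) f)
    (upper (psub (f 0) (g 0))) (upper (psub (f 1) (g 0)))
    (upper (psub (f 0) (g 1))) (upper (psub (f 1) (g 1))).
  intros [] [] [] [] [] [] [] []; simpl; congruence.
Qed.

Variant three := t0 | t1 | t2.

Lemma eventually_three (P : three -> nat -> Prop) :
  (forall i, eventually_nat (P i)) -> eventually_nat (fun N => forall i, P i N).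
Proof.
  intros H; apply (eventually_mono (P := fun N => P t0 N /\ P t1 N /\ P t2 N)).
  - intros N (H0 & H1 & H2) []; assumption.
  - repeat apply eventually_and; apply H.
Qed.

(** * Parity relations between disjoint paths of a drawing *)

Section Drawing.

Variables (V : Type) (adj : V -> V -> Prop).
Variables (pos : V -> R * R) (arc : V -> V -> R -> R * R).

Hypothesis pos_inj : forall u v, pos u = pos v -> u = v.
Hypothesis arcP : forall u v, adj u v -> arc_from_to (arc u v) (pos u) (pos v).
Hypothesis arc_avoids : forall u v w t, adj u v -> 0 < t < 1 -> arc u v t <> pos w.
Hypothesis arc_disjoint : forall u v u' v' s t, adj u v -> adj u' v' ->
  ~ (u = u' /\ v = v') -> ~ (u = v' /\ v = u') ->
  0 < s < 1 -> 0 < t < 1 -> arc u v s <> arc u' v' t.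

Fixpoint is_path (a : V) (l : list V) : Prop :=
  match l with nil => True | b :: l' => adj a b /\ is_path b l' end.

Fixpoint path_end (a : V) (l : list V) : V :=
  match l with nil => a | b :: l' => path_end b l' end.

Fixpoint path_winding (N : nat) (p : R * R) (a : V) (l : list V) : bool :=
  match l with
  | nil => false
  | b :: l' => xorb (winding N p (arc a b)) (path_winding N p b l')
  end.

Let above (u v : V) : bool := upper (psub (pos u) (pos v)).

Definition disjoint_paths (a : V) (l : list V) (c : V) (m : list V) : Prop :=
  forall x y, In x (a :: l) -> In y (c :: m) -> x <> y.

Lemma arcs_disjoint a b c d : adj a b -> adj c d ->
  disjoint_paths a (b :: nil) c (d :: nil) -> disjoint_curves (arc a b) (arc c d).
Proof.
  intros Hab Hcd D s t Hs Ht E.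
  destruct (arcP Hab) as (_ & _ & _ & A0 & A1).
  destruct (arcP Hcd) as (_ & _ & _ & C0 & C1).
  assert (Dac := D a c); assert (Dad := D a d); assert (Dbc := D b c); assert (Dbd := D b d).
  simpl in *.
  destruct (Req_dec s 0) as [->|]; [|destruct (Req_dec s 1) as [->|]];
  (destruct (Req_dec t 0) as [->|]; [|destruct (Req_dec t 1) as [->|]]);
  rewrite ?A0, ?A1, ?C0, ?C1 in E; try (apply pos_inj in E; tauto).
  - symmetry in E; revert E; apply arc_avoids; [assumption | lra].
  - symmetry in E; revert E; apply arc_avoids; [assumption | lra].
  - revert E; apply arc_avoids; [assumption | lra].
  - revert E; apply arc_avoids; [assumption | lra].
  - revert E; apply arc_disjoint; try assumption; try lra; tauto.
Qed.

(** The relation is additive along the path: when an edge is prepended, the terms at the inner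
    vertex occur twice and cancel. *)
Lemma edge_path_relation a b c m : adj a b -> is_path c m ->
  disjoint_paths a (b :: nil) c m ->
  eventually_nat (fun N =>
    xorb (xorb (path_winding N (pos a) c m) (path_winding N (pos b) c m))
         (xorb (winding N (pos c) (arc a b)) (winding N (pos (path_end c m)) (arc a b))) =
    xorb (xorb (above a c) (above b c))
         (xorb (above a (path_end c m)) (above b (path_end c m)))).
Proof.
  intros Hab; revert c; induction m as [|d m IH]; intros c Hm D; simpl.
  - exists O; intros N _.
    destruct (above a c), (above b c), (winding N (pos c) (arc a b)); reflexivity.
  - destruct Hm as [Hcd Hm].
    assert (Dcd : disjoint_paths a (b :: nil) c (d :: nil)).
    { intros x y Hx Hy; apply D; [assumption|]; simpl in *; tauto. }
    assert (Ddm : disjoint_paths a (b :: nil) d m).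
    { intros x y Hx Hy; apply D; [assumption|]; now right. }
    destruct (arcP Hab) as (F1 & F2 & _ & A0 & A1).
    destruct (arcP Hcd) as (G1 & G2 & _ & C0 & C1).
    assert (W := winding_disjoint (conj F1 F2) (conj G1 G2) (arcs_disjoint Hab Hcd Dcd)).
    refine (eventually_mono _ (eventually_and (IH d Hm Ddm) W)).
    rewrite A0, A1, C0, C1; intros N; apply xorb_combine; unfold above; simpl; btauto.
Qed.

Lemma path_relation a l c m : is_path a l -> is_path c m -> disjoint_paths a l c m ->
  eventually_nat (fun N =>
    xorb (xorb (path_winding N (pos a) c m) (path_winding N (pos (path_end a l)) c m))
         (xorb (path_winding N (pos c) a l) (path_winding N (pos (path_end c m)) a l)) =
    xorb (xorb (above a c) (above (path_end a l) c))
         (xorb (above a (path_end c m)) (above (path_end a l) (path_end c m)))).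
Proof.
  intros Hl Hm; revert a Hl; induction l as [|b l IH]; intros a Hl D; simpl.
  - exists O; intros N _.
    destruct (above a c), (above a (path_end c m)), (path_winding N (pos a) c m); reflexivity.
  - destruct Hl as [Hab Hl].
    assert (Dab : disjoint_paths a (b :: nil) c m).
    { intros x y Hx Hy; apply D; [|assumption]; simpl in *; tauto. }
    assert (Dbl : disjoint_paths b l c m).
    { intros x y Hx Hy; apply D; [|assumption]; now right. }
    refine (eventually_mono _ (eventually_and (IH b Hl Dbl) (edge_path_relation Hab Hm Dab))).
    intros N; apply xorb_combine; simpl; btauto.
Qed.

(* Summing the 18 relations between independent edges modulo 2, every winding
   parity occurs twice, while the half-plane terms add up to 1. *)
Lemma no_K33_paths (a b : three -> V) (P : three -> three -> list V) :
  (forall i j, is_path (a i) (P i j)) ->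
  (forall i j, path_end (a i) (P i j) = b j) ->
  (forall i j i' j', i <> i' -> j <> j' ->
     disjoint_paths (a i) (P i j) (a i') (P i' j')) -> False.
Proof.
  intros HP He HD.
  assert (nb : forall i j, i <> j -> above (b i) (b j) = negb (above (b j) (b i))).
  { intros i j Hij; unfold above; apply upper_psub; intros E; apply pos_inj in E.
    assert (exists k l : three, k <> l) as (k & l & Hkl) by (exists t0, t1; discriminate).
    assert (in_end : forall (l : list V) x, In (path_end x l) (x :: l)).
    { clear; intros l; induction l as [|y l IH]; intros x; simpl; [now left|].
      right; exact (IH y). }
    apply (HD k i l j Hkl Hij (b i) (b j)); [| | exact E]; rewrite <- (He k), ?He.
    - rewrite <- (He k i); apply in_end.
    - rewrite <- (He l j); apply in_end. }
  assert (rel : eventually_nat (fun N => forall i i' j j', i <> i' -> j <> j' ->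
    xorb (xorb (path_winding N (pos (a i)) (a i') (P i' j'))
               (path_winding N (pos (b j)) (a i') (P i' j')))
         (xorb (path_winding N (pos (a i')) (a i) (P i j))
               (path_winding N (pos (b j')) (a i) (P i j))) =
    xorb (xorb (above (a i) (a i')) (above (b j) (a i')))
         (xorb (above (a i) (b j')) (above (b j) (b j'))))).
  { do 4 (apply eventually_three; intro).
    destruct (classic (i = i0)) as [|Hi]; [exists O; tauto|].
    destruct (classic (i1 = i2)) as [|Hj]; [exists O; tauto|].
    refine (eventually_mono _ (path_relation (HP i i1) (HP i0 i2) (HD _ _ _ _ Hi Hj))).
    rewrite !He; auto. }
  destruct rel as [N rel]; specialize (rel N (Nat.le_refl N)).
  pose (A k i j := path_winding N (pos (a k)) (a i) (P i j)).
  pose (B k i j := path_winding N (pos (b k)) (a i) (P i j)).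
  pose (K1 i j := above (a i) (a j)); pose (K2 i j := above (b i) (a j)).
  pose (K3 i j := above (a i) (b j)); pose (K4 i j := above (b i) (b j)).
  assert (rel' : forall i i' j j', i <> i' -> j <> j' ->
    xorb (xorb (A i i' j') (B j i' j')) (xorb (A i' i j) (B j' i j)) =
    xorb (xorb (K1 i i') (K2 j i')) (xorb (K3 i j') (K4 j j'))) by exact rel.
  assert (nK : forall i j, i <> j -> K4 i j = negb (K4 j i)) by exact nb.
  clearbody A B K1 K2 K3 K4; clear - rel' nK.
  pose (L i i' j j' := xorb (xorb (A i i' j') (B j i' j')) (xorb (A i' i j) (B j' i j))).
  pose (M i i' j j' := xorb (xorb (K1 i i') (K2 j i')) (xorb (K3 i j') (K4 j j'))).
  pose (all (F : three -> three -> three -> three -> bool) i i' :=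
                      xorb (xorb (F i i' t0 t1) (xorb (F i i' t1 t0) (F i i' t0 t2)))
                           (xorb (F i i' t2 t0) (xorb (F i i' t1 t2) (F i i' t2 t1)))).
  assert (E : xorb (all L t0 t1) (xorb (all L t0 t2) (all L t1 t2)) =
              xorb (all M t0 t1) (xorb (all M t0 t2) (all M t1 t2))).
  { assert (LM : forall i i', i <> i' -> all L i i' = all M i i').
    { intros i i' Hi; unfold all, L, M; rewrite !rel' by (assumption || discriminate); reflexivity. }
    rewrite !LM by discriminate; reflexivity. }
  assert (EL : xorb (all L t0 t1) (xorb (all L t0 t2) (all L t1 t2)) = false).
  { unfold all, L; btauto. }
  (* For each of the three pairs of indices [i], three pairs of indices [j] contribute
     [K4 j j' + K4 j' j = 1]: nine ones in all. Every other term occurs an even number of times. *)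
  assert (EM : xorb (all M t0 t1) (xorb (all M t0 t2) (all M t1 t2)) = true).
  { unfold all, M; rewrite (nK t1 t0), (nK t2 t0), (nK t2 t1) by discriminate; btauto. }
  congruence.
Qed.

End Drawing.

(** * Minors and transfer of planarity between graphs *)

Section Minor.

Variables (V : Type) (adj : V -> V -> Prop).

Inductive reach (S : V -> Prop) : V -> V -> Prop :=
| reach_refl x : S x -> reach S x x
| reach_step x y z : S x -> adj x y -> reach S y z -> reach S x z.

Definition connected_set (S : V -> Prop) : Prop :=
  exists c, S c /\ forall x, S x -> reach S x c.

Definition K33_minor (A B : three -> V -> Prop) : Prop :=
  (forall i j x, A i x -> A j x -> i = j) /\
  (forall i j x, B i x -> B j x -> i = j) /\
  (forall i j x, A i x -> B j x -> False) /\
  (forall i, connected_set (A i)) /\ (forall j, connected_set (B j)) /\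
  (forall i j, exists x y, A i x /\ B j y /\ adj x y).

Hypothesis adj_sym : forall x y, adj x y -> adj y x.

Lemma reach_mono (S T : V -> Prop) x y :
  (forall z, S z -> T z) -> reach S x y -> reach T x y.
Proof. intros H; induction 1; econstructor; eauto. Qed.

Lemma reach_trans S x y z : reach S x y -> reach S y z -> reach S x z.
Proof. induction 1; intros; [assumption | econstructor; eauto]. Qed.

Lemma reach_end S x y : reach S x y -> S x /\ S y.
Proof. induction 1; tauto. Qed.

Lemma reach_sym S x y : reach S x y -> reach S y x.
Proof.
  induction 1 as [x Sx | x y z Sx xy yz IH]; [now constructor|].
  apply (reach_trans IH); destruct (reach_end yz) as [Sy _].
  apply reach_step with x; [assumption | now apply adj_sym | now constructor].
Qed.

Lemma reach_path S x y : reach S x y ->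
  exists l, is_path adj x l /\ path_end x l = y /\ forall z, In z (x :: l) -> S z.
Proof.
  induction 1 as [x Sx | x y z Sx xy yz [l (Hl & He & HS)]].
  - exists nil; repeat split; intros z [<-|[]]; assumption.
  - exists (y :: l); repeat split; try assumption.
    intros t [<-|Ht]; [assumption | now apply HS].
Qed.

(* Paths between the centres of the branch sets suffice: only those joining
   disjoint pairs of branch sets have to be disjoint. *)
Theorem K33_minor_not_planar A B :
  @planar_graph V (fun _ => True) eq adj -> K33_minor A B -> False.
Proof.
  intros (pos & arc & Hpos & Harc & Hav & Hdis) (DA & DB & DAB & CA & CB & E).
  destruct (choice _ CA) as [a Ha]; destruct (choice _ CB) as [b Hb].
  assert (paths : forall i j, exists l, is_path adj (a i) l /\ path_end (a i) l = b j /\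
            forall z, In z (a i :: l) -> A i z \/ B j z).
  { intros i j; apply (reach_path (S := fun z => A i z \/ B j z)).
    destruct (E i j) as (x & y & Hx & Hy & Hxy).
    destruct (Ha i) as [Hai Hri]; destruct (Hb j) as [Hbj Hrj].
    apply reach_trans with x.
    - apply reach_sym; refine (reach_mono _ (Hri x Hx)); tauto.
    - apply reach_step with y; [tauto | assumption |].
      refine (reach_mono _ (Hrj y Hy)); tauto. }
  pose (P i j := proj1_sig (constructive_indefinite_description _ (paths i j))).
  assert (HP := fun i j => proj2_sig (constructive_indefinite_description _ (paths i j))).
  change (forall i j, is_path adj (a i) (P i j) /\ path_end (a i) (P i j) = b j /\
            forall z, In z (a i :: P i j) -> A i z \/ B j z) in HP.
  apply (no_K33_paths (adj := adj) (pos := pos) (arc := arc)) with (a := a) (b := b) (P := P).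
  - intros u v; now apply Hpos.
  - intros u v; now apply Harc.
  - intros u v w t; now apply Hav.
  - intros u v u' v' s t; now apply Hdis.
  - intros i j; apply HP.
  - intros i j; apply HP.
  - intros i j i' j' Hi Hj x y Hx Hy <-.
    destruct (HP i j) as (_ & _ & H1); destruct (HP i' j') as (_ & _ & H2).
    destruct (H1 x Hx), (H2 x Hy); eauto.
Qed.

End Minor.

Lemma planar_graph_pullback (V W : Type) (isW : W -> Prop) (eqv adjW : W -> W -> Prop)
    (adj : V -> V -> Prop) (phi : V -> W) :
  (forall v, isW (phi v)) -> (forall u v, eqv (phi u) (phi v) <-> u = v) ->
  (forall u v, adj u v -> adjW (phi u) (phi v)) ->
  @planar_graph W isW eqv adjW -> @planar_graph V (fun _ => True) eq adj.
Proof.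
  intros Hv He Ha (pos & arc & Hpos & Harc & Hav & Hdis).
  exists (fun v => pos (phi v)), (fun u v => arc (phi u) (phi v)); repeat split.
  - intros E; apply He, Hpos; auto.
  - intros ->; reflexivity.
  - apply (Harc (phi u) (phi v)); auto.
  - apply (Harc (phi u) (phi v)); auto.
  - apply (Harc (phi u) (phi v)); auto.
  - apply (Harc (phi u) (phi v)); auto.
  - apply (Harc (phi u) (phi v)); auto.
  - intros u v w t _ _ _ uv; apply Hav; auto.
  - intros u v u' v' s t _ _ _ _ uv uv'; rewrite <- !He; apply Hdis; auto.
Qed.

Definition image_set (V W : Type) (phi : V -> W) (S : V -> Prop) : W -> Prop :=
  fun y => exists x, S x /\ y = phi x.

Lemma K33_minor_image (V W : Type) (adj : V -> V -> Prop) (adjW : W -> W -> Prop)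
    (phi : V -> W) (A B : three -> V -> Prop) :
  (forall u v, phi u = phi v -> u = v) ->
  (forall u v, adj u v -> adjW (phi u) (phi v)) ->
  K33_minor adj A B ->
  K33_minor adjW (fun i => image_set phi (A i)) (fun i => image_set phi (B i)).
Proof.
  intros inj Ha (DA & DB & DAB & CA & CB & E).
  assert (C : forall S, connected_set adj S -> connected_set adjW (image_set phi S)).
  { intros S (c & Sc & H); exists (phi c); split; [now exists c|].
    intros y (x & Sx & ->); specialize (H x Sx).
    induction H as [x _ | x z c _ xz zc IH]; [now constructor; exists x|].
    destruct (reach_end zc) as [Sz _].
    apply reach_step with (phi z); [now exists x | now apply Ha | now apply IH]. }
  repeat split.
  - intros i j y (x & Hx & ->) (z & Hz & Ez); apply inj in Ez; subst z; eauto.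
  - intros i j y (x & Hx & ->) (z & Hz & Ez); apply inj in Ez; subst z; eauto.
  - intros i j y (x & Hx & ->) (z & Hz & Ez); apply inj in Ez; subst z; eauto.
  - intros i; apply C, CA.
  - intros j; apply C, CB.
  - intros i j; destruct (E i j) as (x & y & Hx & Hy & xy).
    exists (phi x), (phi y); repeat split; [now exists x | now exists y | now apply Ha].
Qed.

From HB Require Import structures.
From mathcomp Require Import all_boot all_fingroup all_solvable.
From mathcomp Require Import ssralg finalg vcharacter.

Close Scope R_scope.
From mathcomp Require Import zify.
Import FiniteModule.
Local Open Scope nat_scope.
Local Open Scope group_scope.

(** * K_{3,3} minors in subgroup lattices *)

Section SubgroupLattice.

Variable gT : finGroupType.
Implicit Types G H K L M N W X Y : {group gT}.

Definition cover X Y : Prop := maximal X Y \/ maximal Y X.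

Lemma cover_sym X Y : cover X Y -> cover Y X.
Proof. by case; [right | left]. Qed.

Definition K33_in G : Prop :=
  exists A B : three -> {group gT} -> Prop,
    K33_minor cover A B /\
    forall i X, A i X \/ B i X -> X \subset G.

Definition K33_free G : Prop := ~ K33_in G.

Lemma K33_freeS H G : H \subset G -> K33_free G -> K33_free H.
Proof.
move=> sHG nG [A [B [AB sH]]]; apply: nG; exists A, B; split=> // i X /sH sXH.
exact: subset_trans sXH sHG.
Qed.

Lemma maximal_between M W X :
  maximal M W -> M \subset X -> X \subset W -> X = M \/ X = W.
Proof.
move=> maxM sMX sXW; have /maximal_eqP[_ max] : maximal_eq M W.
  by rewrite /maximal_eq maxM orbT.
by case: (max X) => // eqX; [left | right]; apply/val_inj.
Qed.

Lemma maximal_sub M W : maximal M W -> M \subset W.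
Proof. by move/maxgroupp/proper_sub. Qed.

Lemma maximal_ltn M W : maximal M W -> #|M| < #|W|.
Proof. by move/maxgroupp/proper_card. Qed.

Lemma maximal_sub_eq M N W : maximal M W -> maximal N W -> M \subset N -> M = N.
Proof.
move=> maxM maxN sMN; case: (maximal_between maxM sMN (maximal_sub maxN)) => // eN.
by have := maximal_ltn maxN; rewrite eN ltnn.
Qed.

(** This produces the edges between branch sets and hubs: along a maximal chain from [H] to [K], the
    covering pair at which [P] is lost joins a group of one set to a group of the other. *)
Lemma chain_step (P : {group gT} -> Prop) H K :
  H \subset K -> P H -> ~ P K ->
  exists X Y, [/\ maximal X Y, H \subset X, Y \subset K, P X & ~ P Y].
Proof.
elim: {K}_.+1 {-2}K (ltnSn #|K|) => // n IHn K leKn sHK PH nPK.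
have [eHK | [M maxM sHM]] := maximal_exists sHK.
  by case: nPK; have <- : H = K by apply/val_inj.
have [PM | nPM] := classic (P M); first by exists M, K; split.
have ltMn : #|M| < n by apply: leq_trans (maximal_ltn maxM) _.
have [X [Y [maxXY sHX sYM PX nPY]]] := IHn M ltMn sHM PH nPM.
by exists X, Y; split=> //; apply: subset_trans sYM (maximal_sub maxM).
Qed.

Lemma reach_sub (S : {group gT} -> Prop) H K :
  H \subset K -> (forall X, H \subset X -> X \subset K -> S X) ->
  reach cover S K H.
Proof.
elim: {K}_.+1 {-2}K (ltnSn #|K|) => // n IHn K leKn sHK SX.
have SK : S K by apply: SX.
have [eHK | [M maxM sHM]] := maximal_exists sHK.
  by have -> : H = K by [apply/val_inj]; apply: reach_refl.
have sMK := maximal_sub maxM.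
apply: (reach_step SK (y := M)); first by right.
apply: IHn => //; first by apply: leq_trans (maximal_ltn maxM) _.
by move=> X sHX sXM; apply: SX => //; apply: subset_trans sMK.
Qed.

(** The branch sets below are unions of intervals having the centre [C] as an end, and maximal
    chains connect an interval. *)
Lemma connected_from (S : {group gT} -> Prop) C :
  S C ->
  (forall X, S X -> (X \subset C /\ forall Y, X \subset Y -> Y \subset C -> S Y) \/
                    (C \subset X /\ forall Y, C \subset Y -> Y \subset X -> S Y)) ->
  connected_set cover S.
Proof.
move=> SC SX; exists C; split=> // X /SX [[sXC SY] | [sCX SY]]; last exact: reach_sub.
exact/(reach_sym cover_sym)/reach_sub.
Qed.

Definition triple (T : Type) (x y z : T) (i : three) : T :=
  match i with t0 => x | t1 => y | t2 => z end.

Lemma triple_inj (T : Type) (x y z : T) : x <> y -> x <> z -> y <> z ->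
  forall i j, triple x y z i = triple x y z j -> i = j.
Proof.
by move=> nxy nxz nyz [] [] //= e; congruence.
Qed.

Lemma K33_in_intro G (A : three -> {group gT} -> Prop) (B0 B1 B2 : {group gT} -> Prop) :
  (forall i X, A i X -> X \subset G) ->
  (forall X, B0 X \/ B1 X \/ B2 X -> X \subset G) ->
  (forall i j X, A i X -> A j X -> i = j) ->
  (forall X, B0 X -> B1 X -> False) -> (forall X, B0 X -> B2 X -> False) ->
  (forall X, B1 X -> B2 X -> False) ->
  (forall i X, A i X -> B0 X \/ B1 X \/ B2 X -> False) ->
  (forall i, connected_set cover (A i)) -> connected_set cover B0 ->
  connected_set cover B1 -> connected_set cover B2 ->
  (forall i, exists X Y, [/\ A i X, B0 Y & cover X Y]) ->
  (forall i, exists X Y, [/\ A i X, B1 Y & cover X Y]) ->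
  (forall i, exists X Y, [/\ A i X, B2 Y & cover X Y]) ->
  K33_in G.
Proof.
move=> sA sB dA d01 d02 d12 dAB cA c0 c1 c2 e0 e1 e2.
exists A, (triple B0 B1 B2); split; last first.
  by move=> i X [/sA // | BX]; apply: sB; case: i BX => /=; tauto.
have BE i X : triple B0 B1 B2 i X -> B0 X \/ B1 X \/ B2 X by case: i => /=; tauto.
split=> //; split.
  by case=> [] [] X //= h1 h2; exfalso;
    solve [exact: (d01 X) | exact: (d02 X) | exact: (d12 X)].
split; first by move=> i j X /dAB dX /BE.
split=> //; split; first by case.
by move=> i; case=> /=; [case: (e0 i) | case: (e1 i) | case: (e2 i)] => X [Y [? ? ?]];
  exists X, Y.
Qed.

Lemma three_other (i : three) : exists j, i <> j.
Proof. by case: i; [exists t1 | exists t0 | exists t0]. Qed.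

(* Branch sets: the groups meeting [W] in [M i], prolonged below [M i];
   hubs: [W], the groups above [W], the groups below two of the [M i]. *)
Lemma K33_three_maximals G W (M B : three -> {group gT}) :
  W \subset G -> (forall i, maximal (M i) W) -> (forall i j, M i = M j -> i = j) ->
  (forall i, B i \subset G) -> (forall i, M i \proper B i) ->
  (forall i, ~~ (W \subset B i)) -> K33_in G.
Proof.
move=> sWG maxM injM sBG ltMB nWB.
have sMW i := maximal_sub (maxM i).
have sMG i : M i \subset G := subset_trans (sMW i) sWG.
have nsM i j : i <> j -> ~ M i \subset M j.
  by move=> neq sij; apply: neq; apply/injM/(maximal_sub_eq (maxM i) (maxM j)).
have nsWM i : ~ W \subset M i.
  by move=> sWM; have := maximal_ltn (maxM i); rewrite ltnNge subset_leq_card.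
pose A i X := [/\ M i \subset X, X \subset G & ~ W \subset X] \/
              (X \subset M i /\ forall j, j <> i -> ~ X \subset M j).
pose B0 X := X = W.
pose B1 X := W \proper X /\ X \subset G.
pose B2 X := exists i j, [/\ i <> j, X \subset M i & X \subset M j].
have AM i : A i (M i) by left.
apply: (@K33_in_intro G A B0 B1 B2).
- by move=> i X [[] // | [sXM _]]; apply: subset_trans sXM (sMG i).
- by move=> X [-> // | [[] // | [i [j [_ sXM _]]]]]; apply: subset_trans sXM (sMG i).
- move=> i j X [[sMX _ nWX] | [sXM nX]] [[sMX' _ nWX'] | [sXM' nX']];
    apply: NNPP => neq.
  + have sXW : X :&: W = M i.
      have sMXW : M i \subset X :&: W by rewrite subsetI sMX sMW.
      have [eXW | eXW] := maximal_between (maxM i) sMXW (subsetIr X W).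
        by rewrite -[LHS]/(gval (X :&: W)%G) eXW.
      by case: nWX; apply/setIidPr; rewrite -[LHS]/(gval (X :&: W)%G) eXW.
    by apply: (nsM j i); [auto | rewrite -sXW subsetI sMX' sMW].
  + exact: (nsM i j neq (subset_trans sMX sXM')).
  + by apply: (nsM j i _ (subset_trans sMX' sXM)) => eji; apply: neq.
  + by apply: (nX j) => // eji; apply: neq.
- by move=> X ->; rewrite /B1 properxx; case.
- by move=> X -> [i [j [_ sWM _]]]; apply: nsWM sWM.
- move=> X [/proper_sub sWX _] [i [j [_ sXM _]]]; exact: (nsWM i (subset_trans sWX sXM)).
- move=> i X [[sMX _ nWX] | [sXM nX]] [eX | [[/proper_sub sWX _] | [k [l [neq sXk sXl]]]]].
  + by apply: nWX; rewrite eX.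
  + exact: nWX.
  + have [eik | neik] := classic (k = i).
      by apply: (nsM i l) (subset_trans sMX sXl); rewrite -eik.
    by apply: (nsM i k) (subset_trans sMX sXk) => eik; apply: neik.
  + by apply: (nsWM i); rewrite -eX.
  + exact: (nsWM i (subset_trans sWX sXM)).
  + have [eik | neik] := classic (k = i); last exact: (nX k).
    by apply: (nX l) => // eil; apply: neq; rewrite eik.
- move=> i; apply: (connected_from (AM i)) => X [[sMX sXG nWX] | [sXM nX]].
    right; split=> // Y sMY sYX; left; split=> //; first exact: subset_trans sXG.
    by move=> sWY; apply: nWX; apply: subset_trans sYX.
  left; split=> // Y sXY sYM; right; split=> // j neq sYj.
  by apply: (nX j neq); apply: subset_trans sYj.
- by apply: (@connected_from _ W) => // X ->; left; split=> // Y sWY sYW;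
    apply/val_inj/eqP; rewrite eqEsubset sYW.
- apply: (@connected_from _ G).
    split=> //; rewrite properE sWG /=; apply/negP=> sGW.
    case/negP: (nWB t0).
    have [eB | ->] := maximal_between (maxM t0) (proper_sub (ltMB t0))
      (subset_trans (sBG t0) sGW); last by [].
    by have := ltMB t0; rewrite eB properxx.
  move=> X [ltWX sXG]; left; split=> // Y sXY sYG; split=> //.
  exact: proper_sub_trans sXY.
- apply: (@connected_from _ 1%G).
    by exists t0, t1; split; rewrite ?sub1G.
  move=> X [i [j [neq sXi sXj]]]; right; split; first exact: sub1G.
  by move=> Y _ sYX; exists i, j; split; rewrite ?(subset_trans sYX).
- by move=> i; exists (M i), W; split=> //; left.
(* A chain from [B i] to [G] enters the hub above [W] at the first group [Y] containing [W]. Here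
   [Y] is not [W], since otherwise [X] would lie strictly between [M i] and [W]. *)
- move=> i; have [||X [Y [maxXY sBX sYG nWX /NNPP sWY]]] :=
    @chain_step (fun X => ~ W \subset X) (B i) G (sBG i).
  + exact/negP/nWB.
  + by move/(_ sWG).
  have sMX := subset_trans (proper_sub (ltMB i)) sBX.
  exists X, Y; split; last by left.
    by left; split=> //; apply: subset_trans (maximal_sub maxXY) sYG.
  split=> //; rewrite properEneq sWY andbT; apply/eqP=> eWY.
  have eWYg : W = Y by apply/val_inj.
  have sXW : X \subset W by rewrite eWYg (maximal_sub maxXY).
  have [eX | eX] := maximal_between (maxM i) sMX sXW.
    by have := proper_sub_trans (ltMB i) sBX; rewrite eX properxx.
  by apply: nWX; rewrite eX.
- move=> i; have [j nij] := three_other i.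
  have [||X [Y [maxXY _ sYM BX nBY]]] := @chain_step B2 1%G (M i) (sub1G _).
  + by exists t0, t1; split; rewrite ?sub1G.
  + case=> k [l [neq sMk sMl]].
    have [eik | neik] := classic (k = i).
      by apply: (nsM i l) sMl; rewrite -eik.
    by apply: (nsM i k) sMk => eik; apply: neik.
  exists Y, X; split=> //; last by right.
  right; split=> // k neq sYk; apply: nBY; exists i, k; split=> //.
  by move=> eik; apply: neq.
Qed.

(* Branch sets: the groups in [N i] not below [W], prolonged above [N i];
   hubs: [W], the groups below [W], the groups above two of the [N i]. *)
Lemma K33_three_covers G W (N L : three -> {group gT}) :
  W :!=: 1 -> (forall i, N i \subset G) -> (forall i, maximal W (N i)) ->
  (forall i j, N i = N j -> i = j) -> (forall i, L i \proper N i) ->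
  (forall i, ~~ (L i \subset W)) -> K33_in G.
Proof.
move=> ntW sNG maxW injN ltLN nLW.
have sWN i := maximal_sub (maxW i).
have nsN i j : i <> j -> ~ N i \subset N j.
  move=> neq sij; apply: neq; apply: injN.
  have [eNW | //] := maximal_between (maxW j) (sWN i) sij.
  by have := maximal_ltn (maxW i); rewrite eNW ltnn.
have nsNW i : ~ N i \subset W.
  by move=> sNW; have := maximal_ltn (maxW i); rewrite ltnNge subset_leq_card.
pose A i X := (X \subset N i /\ ~ X \subset W) \/
              [/\ N i \subset X, X \subset G & forall j, j <> i -> ~ N j \subset X].
pose B0 X := X = W.
pose B1 X := X \proper W.
pose B2 X := [/\ X \subset G & exists i j, [/\ i <> j, N i \subset X & N j \subset X]].
have AN i : A i (N i) by left.
have sWG : W \subset G := subset_trans (sWN t0) (sNG t0).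
apply: (@K33_in_intro G A B0 B1 B2).
- by move=> i X [[sXN _] | [] //]; apply: subset_trans sXN (sNG i).
- by move=> X [-> // | [/proper_sub sXW | [] //]]; apply: subset_trans sXW sWG.
- move=> i j X [[sXN nXW] | [sNX sXG nX]] [[sXN' nXW'] | [sNX' sXG' nX']];
    apply: NNPP => neq.
  + have sW : W \subset N i :&: N j by rewrite subsetI !sWN.
    have [eW | eN] := maximal_between (maxW i) sW (subsetIl (N i) (N j)).
      by apply: nXW; rewrite -[gval W]/(gval W) -eW subsetI sXN.
    by apply: (nsN i j neq); rewrite -eN subsetIr.
  + by apply: (nsN j i _ (subset_trans sNX' sXN)) => eji; apply: neq.
  + exact: (nsN i j neq (subset_trans sNX sXN')).
  + by apply: (nX j) => // eji; apply: neq.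
- by move=> X ->; rewrite /B1 properxx.
- by move=> X -> [_ [i [j [_ sNW _]]]]; apply: nsNW sNW.
- move=> X /proper_sub sXW [_ [i [j [_ sNX _]]]]; exact: (nsNW i (subset_trans sNX sXW)).
- move=> i X [[sXN nXW] | [sNX sXG nX]] [eX | [/proper_sub sXW | [_ [k [l [neq sk sl]]]]]].
  + by apply: nXW; rewrite eX.
  + exact: nXW.
  + have [eik | neik] := classic (k = i).
      by apply: (nsN l i) (subset_trans sl sXN); rewrite -eik => elk; apply: neq.
    exact: (nsN k i neik (subset_trans sk sXN)).
  + by apply: (nsNW i); rewrite -eX.
  + exact: (nsNW i (subset_trans sNX sXW)).
  + have [eik | neik] := classic (k = i); last exact: (nX k).
    by apply: (nX l) => // eil; apply: neq; rewrite eik.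
- move=> i; apply: (connected_from (AN i)) => X [[sXN nXW] | [sNX sXG nX]].
    left; split=> // Y sXY sYN; left; split=> // sYW.
    by apply: nXW; apply: subset_trans sYW.
  right; split=> // Y sNY sYX; right; split=> //; first exact: subset_trans sXG.
  by move=> j neq sNjY; apply: (nX j neq); apply: subset_trans sYX.
- by apply: (@connected_from _ W) => // X ->; left; split=> // Y sWY sYW;
    apply/val_inj/eqP; rewrite eqEsubset sYW.
- apply: (@connected_from _ 1%G); first by rewrite /B1 proper1G.
  move=> X ltXW; right; split=> [|Y _ sYX]; first exact: sub1G.
  exact: sub_proper_trans sYX ltXW.
- apply: (@connected_from _ G); first by split=> //; exists t0, t1; split.
  move=> X [sXG [i [j [neq sNX sNX']]]]; left; split=> // Y sXY sYG; split=> //.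
  by exists i, j; split=> //; apply: subset_trans sXY.
- by move=> i; exists (N i), W; split=> //; right.
(* A chain from 1 to [L i] leaves [W] at a proper subgroup [X] of [W]: if [X] were [W], then [Y]
   would lie strictly between [W] and [N i]. *)
- move=> i; have [||X [Y [maxXY _ sYL sXW nYW]]] :=
    @chain_step (fun X => X \subset W) 1%G (L i) (sub1G _).
  + exact: sub1G.
  + exact/negP/nLW.
  have sYN : Y \subset N i := subset_trans sYL (proper_sub (ltLN i)).
  exists Y, X; split; [by left | | by right].
  rewrite /B1 properEneq sXW andbT; apply/eqP=> eXW.
  have eXWg : X = W by apply/val_inj.
  have sWY : W \subset Y by rewrite -eXWg (maximal_sub maxXY).
  have [eY | eY] := maximal_between (maxW i) sWY sYN.
    by apply: nYW; rewrite eY.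
  by have := sub_proper_trans sYL (ltLN i); rewrite eY properxx.
- move=> i; have [j nij] := three_other i.
  have [||X [Y [maxXY sNX sYG nBX /NNPP BY]]] := @chain_step (fun X => ~ B2 X) (N i) G (sNG i).
  + case=> _ [k [l [neq sk sl]]].
    have [eik | neik] := classic (k = i).
      by apply: (nsN l i) sl; rewrite -eik => elk; apply: neq.
    exact: (nsN k i neik).
  + by case; split=> //; exists t0, t1; split.
  have sXG : X \subset G := subset_trans (maximal_sub maxXY) sYG.
  exists X, Y; split=> //; last by left.
  right; split=> // k neq skX; apply: nBX; split=> //; exists i, k; split=> //.
  by move=> eik; apply: neq.
Qed.

(* Hubs: [Y], the trivial group, the groups above [X0] below two of the [N i]. *)
Lemma K33_common_element Y X0 (N A : three -> {group gT}) :
  (forall i, maximal (N i) Y) -> (forall i, A i \subset N i) ->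
  (forall i, prime #|A i|) -> (forall i j, i <> j -> ~~ (A i \subset N j)) ->
  X0 :!=: 1 -> (forall i, X0 \subset N i) -> K33_in Y.
Proof.
move=> maxN sAN prA nAN ntX0 sX0N.
have sNY i := maximal_sub (maxN i).
pose V i X := (A i \subset X /\ X \subset N i) \/
              [/\ X0 \subset X, X \subset N i & forall j, j <> i -> ~ X \subset N j].
pose B1 X := X = 1%G.
pose B2 X := X0 \subset X /\ exists i j, [/\ i <> j, X \subset N i & X \subset N j].
have VN i : V i (N i) by left.
have sVN i X : V i X -> X \subset N i by case=> [[] | []].
have nAN' i j : i <> j -> ~ A i \subset N j by move/nAN/negP.
have nVB i X : V i X -> B2 X -> False.
  case=> [[sAX sXN] | [sX0X sXN nX]] [_ [k [l [neq sk sl]]]].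
    have [eik | neik] := classic (k = i).
      by apply: (nAN' i l) (subset_trans sAX sl); rewrite -eik.
    by apply: (nAN' i k) (subset_trans sAX sk) => eik; apply: neik.
  have [eik | neik] := classic (k = i); last exact: (nX k).
  by apply: (nX l) => // eil; apply: neq; rewrite eik.
have ntA i : ~ A i \subset 1%G.
  by move/trivGP=> eA; have := prA i; rewrite eA cards1.
apply: (@K33_in_intro Y V (fun X => X = Y) B1 B2).
- by move=> i X /sVN sXN; apply: subset_trans sXN (sNY i).
- move=> X [-> // | [-> | [_ [i [j [_ sXN _]]]]]]; first exact: sub1G.
  exact: subset_trans sXN (sNY i).
- move=> i j X VX VX'; apply: NNPP => neq; case: (VX) (VX') => [[sAX sXN] _ | [sX sXN nX]].
    exact: (nAN' i j neq (subset_trans sAX (sVN _ _ VX'))).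
  by move/sVN; apply: nX => eji; apply: neq.
- by move=> X -> eY; have := maximal_ltn (maxN t0); rewrite eY cards1 ltnNge cardG_gt0.
- move=> X -> [_ [i [j [_ sYN _]]]].
  by have := maximal_ltn (maxN i); rewrite ltnNge subset_leq_card.
- by move=> X -> [/trivGP eX0 _]; rewrite eX0 eqxx in ntX0.
- move=> i X VX [eX | [eX | BX]]; last exact: nVB VX BX.
    by have := maximal_ltn (maxN i); rewrite ltnNge subset_leq_card // -eX sVN.
  case: VX => [[sAX _] | [sX0X _ _]]; first by apply: (ntA i); rewrite -eX.
  by move: sX0X; rewrite eX => /trivGP eX0; rewrite eX0 eqxx in ntX0.
- move=> i; apply: (connected_from (VN i)) => X [[sAX sXN] | [sX0X sXN nX]].
    by left; split=> // Z sXZ sZN; left; split=> //; apply: subset_trans sXZ.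
  left; split=> // Z sXZ sZN; right; split=> //; first exact: subset_trans sXZ.
  by move=> j neq sZj; apply: (nX j neq); apply: subset_trans sZj.
- by apply: (@connected_from _ Y) => // X ->; left; split=> // Z sXZ sZX;
    apply/val_inj/eqP; rewrite eqEsubset sZX.
- apply: (@connected_from _ 1%G) => // X ->; left; split=> // Z _ sZ1.
  exact/val_inj/trivgP.
- apply: (@connected_from _ X0); first by split=> //; exists t0, t1; split.
  move=> X [sX0X [i [j [neq sXi sXj]]]]; right; split=> // Z sZ sZX; split=> //.
  by exists i, j; split=> //; apply: subset_trans sZX _.
- by move=> i; exists (N i), Y; split=> //; left.
- move=> i; exists (A i), 1%G; split=> //; first by left.
  by right; apply: p_index_maximal; rewrite ?sub1G ?indexg1.
- move=> i; have [||X [Z [maxXZ sX0X sZN BX nBZ]]] := @chain_step B2 X0 (N i) (sX0N i).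
  + by split=> //; exists t0, t1; split.
  + by move=> BN; apply: nVB (VN i) BN.
  exists Z, X; split=> //; last by right.
  have sX0Z : X0 \subset Z := subset_trans sX0X (maximal_sub maxXZ).
  right; split=> // k neq sZk; apply: nBZ; split=> //; exists i, k; split=> //.
  by move=> eik; apply: neq.
Qed.

(* Hubs: [Y], the trivial group, the nontrivial groups below [N0]. *)
Lemma K33_common_neighbour Y N0 (N A : three -> {group gT}) :
  maximal N0 Y -> (forall i, maximal (N i) Y) -> (forall i, A i \subset N i) ->
  (forall i, prime #|A i|) -> (forall i j, i <> j -> ~~ (A i \subset N j)) ->
  (forall i, ~~ (A i \subset N0)) -> (forall i, N0 :&: N i != 1) ->
  (forall i j, i <> j -> N0 :&: N i :&: N j = 1) -> K33_in Y.
Proof.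
move=> maxN0 maxN sAN prA nAN nAN0 ntI tiI.
have sNY i := maximal_sub (maxN i).
pose V i X := (A i \subset X /\ X \subset N i) \/
              [/\ N0 :&: N i \subset X, X \subset N i & ~ X \subset N0].
pose B1 X := X = 1%G.
pose B2 X := X :!=: 1 /\ X \subset N0.
have nAN0' i : ~ A i \subset N0 by apply/negP.
have VN i : V i (N i) by left.
have sVN i X : V i X -> X \subset N i by case=> [[] | []].
have nsVN0 i X : V i X -> ~ X \subset N0.
  by case=> [[sAX _] sX | [_ _] //]; apply: (nAN0' i); apply: subset_trans sX.
have ntV i X : V i X -> X :!=: 1.
  by move/nsVN0=> nsX; apply/eqP=> eX; apply: nsX; rewrite eX sub1G.
apply: (@K33_in_intro Y V (fun X => X = Y) B1 B2).
- by move=> i X /sVN sXN; apply: subset_trans sXN (sNY i).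
- move=> X [-> // | [-> | [_ sXN]]]; first exact: sub1G.
  exact: subset_trans sXN (maximal_sub maxN0).
- move=> i j X VX VX'; apply: NNPP => neq.
  have nAX k l : k <> l -> V l X -> ~ A k \subset X.
    by move=> nkl /sVN sX sA; case/negP: (nAN k l nkl); apply: subset_trans sX.
  case: (VX) => [[sAX _] | [sIX _ _]]; first exact: (nAX i j).
  have := ntI i; rewrite -subG1 -(tiI i j neq) subsetI subxx /=.
  by rewrite (subset_trans sIX) ?(sVN j).
- by move=> X -> eY; have := maximal_ltn (maxN t0); rewrite eY cards1 ltnNge cardG_gt0.
- move=> X -> [_ sYN].
  by have := maximal_ltn maxN0; rewrite ltnNge subset_leq_card.
- by move=> X -> [/eqP].
- move=> i X VX [eX | [eX | [_ sX]]]; last exact: nsVN0 VX sX.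
    by have := maximal_ltn (maxN i); rewrite ltnNge subset_leq_card // -eX sVN.
  by have := ntV i X VX; rewrite eX eqxx.
- move=> i; apply: (connected_from (VN i)) => X [[sAX sXN] | [sIX sXN nX]].
    by left; split=> // Z sXZ sZN; left; split=> //; apply: subset_trans sXZ.
  left; split=> // Z sXZ sZN; right; split=> //; first exact: subset_trans sXZ.
  by move=> sZ; apply: nX; apply: subset_trans sZ.
- by apply: (@connected_from _ Y) => // X ->; left; split=> // Z sXZ sZX;
    apply/val_inj/eqP; rewrite eqEsubset sZX.
- apply: (@connected_from _ 1%G) => // X ->; left; split=> // Z _ sZ1.
  exact/val_inj/trivgP.
- have ntsub (X Z : {group gT}) : X :!=: 1 -> X \subset Z -> Z :!=: 1.
    by move=> ntX; apply: contraTneq => ->; rewrite subG1.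
  apply: (@connected_from _ N0); first by split=> //; apply: ntsub (ntI t0) (subsetIl _ _).
  move=> X [ntX sXN]; left; split=> // Z sXZ sZN; split=> //; exact: ntsub sXZ.
- by move=> i; exists (N i), Y; split=> //; left.
- move=> i; exists (A i), 1%G; split=> //; first by left.
  by right; apply: p_index_maximal; rewrite ?sub1G ?indexg1.
- move=> i; have [||X [Z [maxXZ sIX sZN sX nZ]]] :=
    @chain_step (fun X => X \subset N0) (N0 :&: N i)%G (N i) (subsetIr _ _).
  + exact: subsetIl.
  + exact: nsVN0 (VN i).
  exists Z, X; split; last by right.
    by right; split=> //; apply: subset_trans (maximal_sub maxXZ).
  by split=> //; apply: contraNneq (ntI i) => eX; rewrite -subG1 -eX.
Qed.

End SubgroupLattice.

Lemma K33_free_quotient (gT : finGroupType) (G D : {group gT}) :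
  D <| G -> K33_free G -> K33_free (G / D)%G.
Proof.
move=> nDG freeG [A [B [AB sAB]]]; apply: freeG.
pose phi (X : {group coset_of D}) := (coset D @*^-1 X)%G.
exists (fun i => image_set phi (A i)), (fun i => image_set phi (B i)); split.
  apply: K33_minor_image AB => [X Y eXY | X Y].
    by apply/val_inj; rewrite /= -(cosetpreK X) -[coset D @*^-1 X]/(gval (phi X)) eXY cosetpreK.
  by case=> max; [left | right]; rewrite cosetpre_maximal.
have phiG (X : {group coset_of D}) : X \subset G / D -> phi X \subset G.
  by move=> sX; rewrite -[gval G](quotientGK nDG) cosetpreSK.
by move=> i _ [] [X [SX ->]]; apply/phiG/(sAB i); [left | right].
Qed.

(** * Finite groups without K_{3,3} minor *)

(** Every element lies in a maximal subgroup over [Z], and two of these never cover [E]: with [x]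
    only in [M1] and [y] only in [M0], the product [x * y] is in neither. *)
Lemma three_maximals_over (gT : finGroupType) (E Z : {group gT}) :
  Z \subset E -> (forall x, x \in E -> Z <*> <[x]> != E) ->
  exists M : three -> {group gT},
    [/\ forall i, maximal (M i) E, forall i, Z \subset M i &
        forall i j, M i = M j -> i = j].
Proof.
move=> sZE ncE.
have maxE x : x \in E -> exists M : {group gT}, [/\ maximal M E, Z \subset M & x \in M].
  move=> Ex; have sZxE : Z <*> <[x]> \subset E by rewrite join_subG sZE cycle_subG.
  have [eE | [M maxM]] := maximal_exists sZxE; first by case/eqP: (ncE x Ex).
  by rewrite join_subG cycle_subG => /andP[sZM Mx]; exists M.
have [M0 [maxM0 sZM0 _]] := maxE 1 (group1 E).
have /properP[_ [x Ex nM0x]] := maxgroupp maxM0.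
have [M1 [maxM1 sZM1 M1x]] := maxE x Ex.
have neM01 : M0 <> M1 by move=> eM; rewrite eM M1x in nM0x.
have /subsetPn[y M0y nM1y] : ~~ (M0 \subset M1).
  by apply/negP=> /(maximal_sub_eq maxM0 maxM1).
have Ey : y \in E := subsetP (maximal_sub maxM0) y M0y.
have [M2 [maxM2 sZM2 M2xy]] := maxE (x * y) (groupM Ex Ey).
have neM02 : M0 <> M2 by move=> eM; rewrite -eM groupMr // (negPf nM0x) in M2xy.
have neM12 : M1 <> M2 by move=> eM; rewrite -eM groupMl // (negPf nM1y) in M2xy.
exists (triple M0 M1 M2); split; by [case | apply: triple_inj].
Qed.

Lemma cycle_prime_maximal (gT : finGroupType) (x : gT) (r : nat) :
  prime r -> r %| #[x] -> maximal <[x ^+ r]> <[x]>.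
Proof.
move=> r_pr r_dv; have [d def_x] := dvdnP r_dv.
have d_gt0 : 0 < d by have := order_gt0 x; rewrite def_x; case: d {def_x}.
apply: p_index_maximal; rewrite ?cycleX // -divgS ?cycleX //= -!orderE orderXdiv //.
by rewrite def_x mulnK ?prime_gt0 // mulKn.
Qed.

(** Take [d] of least order centralising [E] outside [E]; then [Z = <d ^ r>] lies in the centre of
    [E]. As [E] is nonabelian, no [Z <x>] is all of [E], so three maximal subgroups [M i] contain
    [Z], and the groups [M i <d>] are not comparable with [E]. *)
Lemma K33_free_cent_nonabelian (gT : finGroupType) (G E : {group gT}) :
  K33_free G -> E \subset G -> ~~ abelian E -> 'C_G(E) \subset E.
Proof.
move=> freeG sEG nabE; apply/negPn/negP=> /subsetPn[d0 CGd0 nEd0].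
pose Q := [pred d | (d \in 'C_G(E)) && (d \notin E)].
have Qd0 : Q d0 by rewrite /= CGd0.
case: (@arg_minnP _ d0 Q (fun d => #[d]) Qd0) => d /andP[CGd nEd] min_d {d0 CGd0 nEd0 Qd0}.
have /setIP[Gd cEd] := CGd.
have d_gt1 : 1 < #[d] by rewrite order_gt1; apply: contraNneq nEd => ->.
pose r := pdiv #[d]; have r_pr : prime r := pdiv_prime d_gt1.
have r_dv : r %| #[d] := pdiv_dvd _.
have oX : #[d ^+ r] = #[d] %/ r by rewrite orderXdiv.
have Edr : d ^+ r \in E.
  apply/negPn/negP=> nE; have := min_d (d ^+ r); rewrite /= groupX // nE => /(_ isT).
  by rewrite oX leqNgt ltn_Pdiv ?prime_gt1.
pose Z := <[d ^+ r]>%G; have sZE : Z \subset E by rewrite cycle_subG.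
have cEZ : Z \subset 'C(E) by rewrite cycle_subG groupX.
have [x Ex | M [maxM sZM injM]] := three_maximals_over sZE.
  apply: contra nabE => /eqP eE; rewrite -eE abelianY !cycle_abelian /= centsC.
  by apply: subset_trans cEZ (centS _); rewrite cycle_subG.
apply: freeG; apply: (K33_three_maximals (B := fun i => (M i <*> <[d]>)%G) sEG maxM injM).
- by move=> i; rewrite join_subG cycle_subG Gd (subset_trans (maximal_sub (maxM i))).
- move=> i; rewrite properEneq joing_subl andbT; apply: contraNneq nEd => eM.
  apply: (subsetP (maximal_sub (maxM i))); rewrite eM.
  by rewrite -cycle_subG joing_subr.
move=> i; have sME := maximal_sub (maxM i).
have maxZ : maximal Z <[d]>%G := cycle_prime_maximal r_pr r_dv.
have cMd : <[d]> \subset 'C(M i) by rewrite cycle_subG (subsetP (centS sME)).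
apply/negP=> sEB; have := maximal_ltn (maxM i); rewrite ltnNge subset_leq_card //.
(* By Dedekind's law [M i <d>] meets [E] in [M i (<d> :&: E)], and [<d> :&: E = Z] because [Z] is
   maximal in [<d>]. *)
rewrite -(setIidPr sEB) /= cent_joinEr // -group_modl // mul_subG //.
have sZI : Z \subset <[d]> :&: E by rewrite subsetI cycleX.
have [eZ | eZ] := maximal_between maxZ sZI (subsetIl _ _).
  by rewrite -[_ :&: _]/(gval (<[d]> :&: E)%G) eZ sZM.
case/negP: nEd; rewrite -cycle_subG -[<[d]>]/(gval <[d]>%G) -[in X in X \subset _]eZ.
exact: subsetIr.
Qed.

Lemma noncyclic_joing (gT : finGroupType) (P : {group gT}) :
  ~~ cyclic P -> forall x, x \in P -> 1%G <*> <[x]> != P.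
Proof. by move=> ncP x _; apply: contraNneq ncP => <-; rewrite joing1G cycle_cyclic. Qed.

(** Three maximal subgroups [M i] of [P] yield the groups [M i K], which do not contain [P] because
    the [p]-part of their order is that of [M i]. *)
Lemma K33_noncyclic_norm_p' (gT : finGroupType) (G P K : {group gT}) (p : nat) :
  K33_free G -> P \subset G -> K \subset G -> p.-group P -> ~~ cyclic P ->
  p^'.-group K -> P \subset 'N(K) -> K :=: 1.
Proof.
move=> freeG sPG sKG pP ncP p'K nKP; apply/eqP/negPn/negP=> ntK.
have [M [maxM _ injM]] := three_maximals_over (sub1G P) (noncyclic_joing ncP).
have sMP i := maximal_sub (maxM i); have pM i := pgroupS (sMP i) pP.
have nKM i : M i \subset 'N(K) := subset_trans (sMP i) nKP.
apply: freeG; apply: (K33_three_maximals (B := fun i => (M i <*> K)%G) sPG maxM injM).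
- by move=> i; rewrite join_subG sKG (subset_trans (sMP i)).
- move=> i; rewrite properEneq joing_subl andbT; apply: contraNneq ntK => eM.
  have sKM : K \subset M i by rewrite eM joing_subr.
  by rewrite -subG1 -(coprime_TIg (pnat_coprime (pM i) p'K)) subsetI sKM subxx.
move=> i; apply/negP=> sPB; have := maximal_ltn (maxM i).
rewrite ltnNge dvdn_leq ?cardG_gt0 // -(@Gauss_dvdl _ _ #|K|); last exact: pnat_coprime pP p'K.
by rewrite -(coprime_cardMg (pnat_coprime (pM i) p'K)) -norm_joinEl // cardSg.
Qed.

Lemma coprime_cent_mul_normal (gT : finGroupType) (S H A : {group gT}) :
  H <| S -> A \subset 'N(H) -> coprime #|S| #|A| -> solvable S ->
  [~: S, A] \subset H -> S \subset H * 'C_S(A).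
Proof.
move=> nsHS nHA coSA solS sSAH; have nHS := normal_norm nsHS.
rewrite -quotientSK // coprime_quotient_cent ?(normal_sub nsHS) // subsetI subxx /=.
exact: quotient_cents2r.
Qed.

Lemma coprime_cent_Phi (gT : finGroupType) (S A : {group gT}) :
  S \subset 'Phi(S) * 'C_S(A) -> A \subset 'C(S).
Proof.
move=> sS; suff eS : <<'C_S(A)>> = S by rewrite centsC -eS gen_subG subsetIr.
apply: Phi_nongen; apply/eqP; rewrite eqEsubset join_subG Phi_sub subsetIl.
by apply: subset_trans sS _; apply: mul_subG (joing_subl _ _) (joing_subr _ _).
Qed.

(* If there are at most two conjugates, [A] acts trivially on both factors of
   the series [S > 'N_S('Phi(S) A) > 'Phi(S)], hence on [S]. *)
Lemma coprime_three_conjugates (gT : finGroupType) (S A : {group gT}) (p : nat) :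
  p.-group S -> A \subset 'N(S) -> coprime #|S| #|A| -> ~~ (A \subset 'C(S)) ->
  exists u : three -> gT, (forall i, u i \in S) /\
    forall i j, ('Phi(S) <*> A) :^ u i = ('Phi(S) <*> A) :^ u j -> i = j.
Proof.
move=> pS nSA coSA ncSA; set B := 'Phi(S) <*> A.
have [|small] := ltnP 2 #|B :^: S|.
  case/card_gt2P=> _ [_ [_ [[/imsetP[x Sx ->] /imsetP[y Sy ->] /imsetP[z Sz ->]]]]].
  case=> /eqP nxy /eqP nyz /eqP nzx; exists (triple x y z); split; first by case.
  have inj_B := triple_inj nxy (nesym nzx) nyz.
  by move=> i j eB; apply: inj_B; move: eB; case: i; case: j.
case/negP: ncSA; apply: coprime_cent_Phi.
have solS := pgroup_sol pS; have sPS := Phi_sub S.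
have nPA : A \subset 'N('Phi(S)) := char_norm_trans (Phi_char S) nSA.
have nPS : S \subset 'N('Phi(S)) := normal_norm (Phi_normal S).
pose N := 'N_S(B)%G; have sNS : N \subset S := subsetIl _ _.
have sPN : 'Phi(S) \subset N.
  by rewrite subsetI sPS (subset_trans (joing_subl _ A)) ?normG.
have nsNS : N <| S.
  apply: sub_der1_normal sNS; apply: subset_trans sPN.
  by rewrite (Phi_joing pS) joing_subl.
have nNA : A \subset 'N(N).
  by rewrite normsI // (subset_trans _ (normG 'N(B))) // (subset_trans (joing_subr 'Phi(S) _)) ?normG.
(* By Dedekind's law [B :&: S = 'Phi(S)], and [[N, A]] lies in both [B] and [S]. *)
have sNAP : [~: N, A] \subset 'Phi(S).
  have tiSA : S :&: A = 1 := coprime_TIg coSA.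
  have -> : 'Phi(S) = B :&: S :> {set gT}.
    by rewrite /B norm_joinEr // -group_modl // [A :&: S]setIC tiSA mulg1.
  rewrite subsetI; apply/andP; split.
    rewrite (subset_trans (commgS _ (joing_subr 'Phi(S) A))) // commg_subr.
    exact: subsetIr.
  by rewrite (subset_trans (commSg _ sNS)) ?commg_subl.
have sSAN : [~: S, A] \subset N.
  rewrite gen_subG; apply/subsetP=> _ /imset2P[s a Ss Aa ->].
  have [Ns | nNs] := boolP (s \in N).
    by rewrite commgEl groupM ?groupV // memJ_norm // (subsetP nNA).
  (* With [s] outside [N] and at most two conjugates, the index is exactly two. Then [s] and [s ^ a]
     share the nontrivial coset, which puts [[s, a]] into [N]. *)
  have iN : #|S : N| = 2.
    apply/eqP; rewrite eqn_leq -card_conjugates small /= card_conjugates.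
    by rewrite ltn_neqAle indexg_gt0 andbT eq_sym indexg_eq1; apply: contra nNs => /subsetP->.
  have Nsas : s ^ a \in N :* s.
    rewrite (rcoset_index2 sNS iN) in_setD ?nNs // memJ_norm ?(subsetP nNA) // nNs.
    by rewrite memJ_norm ?(subsetP nSA).
  rewrite commgEl -(mulgKV s (s ^ a)) -conjgE.
  by rewrite memJ_norm ?(subsetP (normal_norm nsNS)) -?mem_rcoset.
have coNA : coprime #|N| #|A| := coprimeSg sNS coSA.
have nPN : 'Phi(S) <| N := normalS sPN sNS (Phi_normal S).
have sS := coprime_cent_mul_normal nsNS nNA coSA solS sSAN.
have sN := coprime_cent_mul_normal nPN nPA coNA (solvableS sNS solS) sNAP.
apply: subset_trans sS _; apply: subset_trans (mulSg _ sN) _.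
by rewrite -mulgA mulgS // mul_subG ?setSI.
Qed.

(** For a counterexample [y] of least order, [K = <y ^ r>] centralises [S], so [W = 'Phi(S) K] is
    normalised by [S] and maximal in [B = 'Phi(S) <y>]. Three conjugates of [B] cover [W], each with
    a conjugate of [<y>] outside [W]. As ['Phi(S)] is nontrivial, so is [W], and [<y>] is proper in
    [B]. *)
Lemma K33_free_p'_cent (gT : finGroupType) (G S : {group gT}) (p : nat) y :
  K33_free G -> S <| G -> p.-group S -> 'Phi(S) != 1 ->
  y \in G -> p^'.-elt y -> y \in 'C(S).
Proof.
move=> freeG nsSG pS ntP Gy p'y; apply/negPn/negP=> ncy.
pose Q := [pred y | [&& y \in G, p^'.-elt y & y \notin 'C(S)]].
have Qy : Q y by rewrite /= Gy p'y.
case: (@arg_minnP _ y Q (fun y => #[y]) Qy) => {Gy p'y ncy Qy} {}y /and3P[Gy p'y ncy] min_y.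
have [sSG nSG] := andP nsSG.
have y_gt1 : 1 < #[y] by rewrite order_gt1; apply: contraNneq ncy => ->; apply: group1.
pose r := pdiv #[y]; have r_pr : prime r := pdiv_prime y_gt1.
have r_dv : r %| #[y] := pdiv_dvd _.
have oX : #[y ^+ r] = #[y] %/ r by rewrite orderXdiv.
have czS : y ^+ r \in 'C(S).
  apply/negPn/negP=> nc; have := min_y (y ^+ r).
  rewrite /= groupX // p_eltX // nc => /(_ isT).
  by rewrite oX leqNgt ltn_Pdiv ?prime_gt1.
pose A := <[y]>%G; pose K := <[y ^+ r]>%G.
have sKA : K \subset A by rewrite cycleX.
have coA (H : {group gT}) : p.-group H -> coprime #|H| #|A|.
  by move=> pH; apply: pnat_coprime pH _.
have coSA := coA S pS.
have sPS := Phi_sub S; have pP := pgroupS sPS pS; have coPA := coA _ pP.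
have nSA : A \subset 'N(S) by rewrite cycle_subG (subsetP nSG).
have nPA : A \subset 'N('Phi(S)) := char_norm_trans (Phi_char S) nSA.
have ncA : ~~ (A \subset 'C(S)) by rewrite cycle_subG.
have [u [Su inj_u]] := coprime_three_conjugates pS nSA coSA ncA.
pose B := ('Phi(S) <*> A)%G; pose W := ('Phi(S) <*> K)%G.
have sWB : W \subset B by rewrite genS // setUS.
have cardB : #|B| = (#|'Phi(S)| * #|A|)%N by rewrite /= norm_joinEr // coprime_cardMg.
have nPK : K \subset 'N('Phi(S)) := subset_trans sKA nPA.
have coPK : coprime #|'Phi(S)| #|K| := coprimegS sKA coPA.
have cardW : #|W| = (#|'Phi(S)| * #|K|)%N by rewrite /= norm_joinEr // coprime_cardMg.
have maxK : maximal K A := cycle_prime_maximal r_pr r_dv.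
have maxW : maximal W B.
  apply: p_index_maximal => //; rewrite -divgS // cardB cardW divnMl // divgS //.
  by rewrite -divgS //= -!orderE oX divnA // mulKn.
have WJ i : W :^ u i = W.
  apply: (normP _); apply: (subsetP _ (u i) (Su i)); apply: normsY.
    exact: normal_norm (Phi_normal S).
  by apply: cents_norm; rewrite centsC cycle_subG.
apply: freeG; apply: (K33_three_covers (W := W) (N := fun i => (B :^ u i)%G)
                                        (L := fun i => (A :^ u i)%G)).
- by apply: contraNneq ntP => eW; rewrite -subG1 -eW joing_subl.
- move=> i; rewrite conj_subG ?(subsetP sSG) // join_subG (subset_trans sPS) //.
  by rewrite cycle_subG.
- by move=> i; rewrite -(WJ i) maximalJ.
- by move=> i j /(congr1 val)/= /inj_u.
- move=> i; rewrite /= properJ properE joing_subr /=; apply: contra ntP => sBA.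
  rewrite -subG1 -(coprime_TIg coPA) subsetI subxx.
  exact: subset_trans (joing_subl _ _) sBA.
- move=> i; rewrite /= -(WJ i) conjSg; apply/negP=> /cardSg.
  have coAP : coprime #|A| #|'Phi(S)| by rewrite coprime_sym.
  rewrite cardW (Gauss_dvdr _ coAP) => /(dvdn_leq (cardG_gt0 K)) leAK.
  by have := maximal_ltn maxK; rewrite ltnNge leAK.
Qed.

(** In a noncyclic [N i], any element outside [D] generates a proper subgroup not contained in
    [D]. *)
Lemma K33_noncyclic_covers (gT : finGroupType) (G D : {group gT})
    (N : three -> {group gT}) :
  D :!=: 1 -> (forall i, N i \subset G) -> (forall i, maximal D (N i)) ->
  (forall i, ~~ cyclic (N i)) -> (forall i j, N i = N j -> i = j) -> K33_in G.
Proof.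
move=> ntD sNG maxD ncN injN.
have ltDN i : exists x, x \in N i /\ x \notin D.
  by have /properP[_ [x]] := maxgroupp (maxD i); exists x.
have [x xP] := choice _ ltDN.
apply: (K33_three_covers (L := fun i => <[x i]>%G) ntD sNG maxD injN) => i.
  have [Nx _] := xP i; rewrite properEneq cycle_subG Nx andbT.
  by apply: contraNneq (ncN i) => <-; apply: cycle_cyclic.
by rewrite cycle_subG; case: (xP i).
Qed.

Lemma maximal_joing_cycle (gT : finGroupType) (D : {group gT}) (w : gT) (p : nat) :
  prime p -> w \in 'N(D) -> w ^+ p \in D -> w \notin D ->
  maximal D (D <*> <[w]>) /\ #|D <*> <[w]>| = (p * #|D|)%N.
Proof.
move=> p_pr nDw Dwp nDw'.
have nD : <[w]> \subset 'N(D) by rewrite cycle_subG.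
have oq : #|(D <*> <[w]>) / D| = p.
  rewrite quotientYidl // quotient_cycle // -orderE.
  apply: nt_prime_order => //; first by rewrite -morphX //= coset_id.
  by apply: contra nDw' => /eqP/coset_idr->.
have sD : D \subset D <*> <[w]> := joing_subl _ _.
have nsD : D <*> <[w]> \subset 'N(D) by rewrite join_subG normG.
have iD : #|D <*> <[w]> : D| = p by rewrite -card_quotient.
by split; [apply: p_index_maximal; rewrite ?iD | rewrite -(Lagrange sD) iD mulnC].
Qed.

(** A single cover [D <w>] accounts for at most [(p - 1) |D|] elements of [S], so a larger set would
    meet a third cover. *)
Lemma K33_free_noncyclic_covers (gT : finGroupType) (G D : {group gT}) (S : {set gT})
    (p : nat) :
  K33_free G -> D :!=: 1 -> prime p -> D \subset G ->
  (forall w, w \in S -> [/\ w \in G, w \in 'N(D), w ^+ p \in D, w \notin D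
                          & ~~ cyclic (D <*> <[w]>)]) ->
  #|S| <= 2 * (p.-1 * #|D|).
Proof.
move=> freeG ntD p_pr sDG HS; rewrite leqNgt; apply/negP=> ltS.
pose X w := (D <*> <[w]>)%G.
have cX w : w \in S -> #|X w :\: D| = (p.-1 * #|D|)%N.
  case/HS=> _ nDw Dwp nDw' _; have [_ oX] := maximal_joing_cycle p_pr nDw Dwp nDw'.
  rewrite cardsD (setIidPr (joing_subl _ _)) oX -{2}[#|D|]mul1n -mulnBl.
  by rewrite subn1.
have notin w1 w2 : w1 \in S -> w2 \in S -> exists w3, [/\ w3 \in S, w3 \notin X w1 & w3 \notin X w2].
  move=> Sw1 Sw2; have /subsetPn[w3 Sw3] : ~~ (S \subset (X w1 :\: D) :|: (X w2 :\: D)).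
    apply: contraL ltS => sS; rewrite -leqNgt; apply: leq_trans (subset_leq_card sS) _.
    by apply: leq_trans (leq_card_setU _ _) _; rewrite !cX // mul2n addnn.
  by have [_ _ _ nD3 _] := HS w3 Sw3; rewrite !inE nD3 negb_or => /andP[? ?]; exists w3.
have [S0 | [w0 Sw0]] := set_0Vmem S; first by rewrite S0 cards0 in ltS.
have [w1 [Sw1 nw10 _]] := notin w0 w0 Sw0 Sw0.
have [w2 [Sw2 nw20 nw21]] := notin w0 w1 Sw0 Sw1.
have Xw w : w \in X w by rewrite -cycle_subG joing_subr.
have ne01 : X w0 <> X w1 by move=> e; rewrite e Xw in nw10.
have ne02 : X w0 <> X w2 by move=> e; rewrite e Xw in nw20.
have ne12 : X w1 <> X w2 by move=> e; rewrite e Xw in nw21.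
pose w := triple w0 w1 w2; have Sw i : w i \in S by case: i.
apply: freeG; apply: (K33_noncyclic_covers (N := fun i => X (w i)) ntD).
- by move=> i; have [Gw _ _ _ _] := HS _ (Sw i); rewrite join_subG sDG cycle_subG.
- by move=> i; have [_ ? ? ? _] := HS _ (Sw i); case: (@maximal_joing_cycle _ D (w i) p).
- by move=> i; have [] := HS _ (Sw i).
have inj_X := triple_inj ne01 ne02 ne12.
by move=> i j eX; apply: inj_X; move: eX; case: i; case: j.
Qed.

Lemma p_expg_Phi (gT : finGroupType) (P : {group gT}) (p : nat) x :
  p.-group P -> x \in P -> x ^+ p \in 'Phi(P).
Proof.
move=> pP Px; rewrite (Phi_joing pP); apply: (subsetP (joing_subr _ _)).
by rewrite -[p in _ ^+ p]expn1 Mho_p_elt // (mem_p_elt pP).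
Qed.

(** Every element outside [D] gives a noncyclic cover of [D]. For index [p ^ k] the count reads
    [p ^ k - 1 <= 2 (p - 1)], which forces [k <= 1] because [p + 1 > 2]. *)
Lemma K33_free_noncyclic_index (gT : finGroupType) (G W D : {group gT}) (p : nat) :
  K33_free G -> W \subset G -> p.-group W -> D <| W -> ~~ cyclic D ->
  'Phi(W) \subset D -> #|W : D| <= p.
Proof.
move=> freeG sWG pW nsDW ncD sPD; have [sDW nDW] := andP nsDW.
have ntD : D :!=: 1 by apply: contraNneq ncD => ->; apply: cyclic1.
have ntW : W :!=: 1 by apply: contraNneq ntD => eW; rewrite -subG1 -eW.
have [p_pr _ _] := pgroup_pdiv pW ntW; have p_gt1 := prime_gt1 p_pr.
have := @K33_free_noncyclic_covers _ G D (W :\: D) p freeG ntD p_pr (subset_trans sDW sWG).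
rewrite cardsD (setIidPr sDW) -(Lagrange sDW) => /(_ _)/wrap[] => [w|].
  case/setDP=> Ww nDw; split=> //; first exact: (subsetP sWG).
  - exact: (subsetP nDW).
  - by rewrite (subsetP sPD) // p_expg_Phi.
  by apply: contra ncD; apply: cyclicS; apply: joing_subl.
rewrite mulnC -{2}[#|D|]mul1n -mulnBl mulnA leq_pmul2r ?cardG_gt0 // => le2.
have pi : p.-nat #|W : D| by rewrite -card_quotient // -pgroupE quotient_pgroup.
have [k ek] := p_natP pi; rewrite {}ek in le2 *.
case: k le2 => [|[|k]] //; first by move=> _; rewrite expn0 ltnW.
rewrite leq_subLR => le2; have : p ^ 2 <= 1 + 2 * p.-1.
  by apply: leq_trans le2; rewrite leq_exp2l.
by case: p p_gt1 {p_pr pW pi le2} => [|[|p]] // _; rewrite expnS expn1 /=; nia.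
Qed.

(** If [W / 'Phi(W)] had rank [k > 3], the preimage [D] of a subgroup of order [p ^ 2] would be
    noncyclic of index [p ^ (k - 2) > p]. *)
Lemma K33_free_Phi_index (gT : finGroupType) (G W : {group gT}) (p : nat) :
  K33_free G -> W \subset G -> p.-group W -> prime p -> #|W : 'Phi(W)| <= p ^ 3.
Proof.
move=> freeG sWG pW p_pr; have nsPW := Phi_normal W.
have pi : p.-nat #|W : 'Phi(W)| by rewrite -card_quotient ?normal_norm // -pgroupE quotient_pgroup.
have [k ek] := p_natP pi; rewrite ek leq_exp2l ?prime_gt1 // leqNgt; apply/negP=> k_gt3.
have abW := Phi_quotient_abelem pW.
have lW : logn p #|W / 'Phi(W)| = k by rewrite card_quotient ?normal_norm // ek pfactorK.
have [|Y [sYW nsYW oY]] := normal_pgroup (r := 2) (quotient_pgroup _ pW) (normal_refl (W / 'Phi(W))).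
  by rewrite lW ltnW // ltnW.
have sPD : 'Phi(W) \subset coset 'Phi(W) @*^-1 Y by apply: sub_cosetpre.
pose D := (coset 'Phi(W) @*^-1 Y)%G.
have eDY : D / 'Phi(W) = Y by apply: cosetpreK.
have nsDW : D <| W.
  by rewrite -(quotientGK nsPW) cosetpre_normal.
have ncD : ~~ cyclic D.
  apply/negP=> /(quotient_cyclic 'Phi(W)); rewrite eDY.
  by rewrite (abelem_cyclic (abelemS sYW abW)) oY pfactorK.
have := K33_free_noncyclic_index freeG sWG pW nsDW ncD sPD.
rewrite leqNgt; case/negP.
have iDP : #|D : 'Phi(W)| = (p ^ 2)%N.
  rewrite -card_quotient ?eDY //; apply: subset_trans (normal_norm nsPW); exact: normal_sub.
have := Lagrange_index (normal_sub nsDW) sPD; rewrite ek iDP => eI.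
have -> : #|W : D| = (p ^ (k - 2))%N.
  have p2_gt0 : 0 < p ^ 2 by rewrite expn_gt0 prime_gt0.
  apply/eqP; rewrite -(eqn_pmul2r p2_gt0) eI -expnD subnK //.
  by rewrite ltnW // ltnW.
by rewrite -{1}(expn1 p) ltn_exp2l ?(prime_gt1 p_pr) // ltn_subRL.
Qed.

Lemma K33_free_Phi_cyclic (gT : finGroupType) (G W : {group gT}) (p : nat) :
  K33_free G -> W \subset G -> p.-group W -> ~~ cyclic W -> cyclic 'Phi(W).
Proof.
move=> freeG sWG pW ncW; have [//|ncP] := boolP (cyclic 'Phi(W)); case/negP: ncW.
have nsPW := Phi_normal W; apply: Phi_quotient_cyclic.
have le_p := K33_free_noncyclic_index freeG sWG pW nsPW ncP (subxx _).
have [-> | ntW] := eqVneq (gval W) 1; first exact/quotient_cyclic/cyclic1.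
have [p_pr _ _] := pgroup_pdiv pW ntW.
rewrite (abelem_cyclic (Phi_quotient_abelem pW)) card_quotient ?normal_norm //.
have pi : p.-nat #|W : 'Phi(W)| by rewrite -card_quotient ?normal_norm // -pgroupE quotient_pgroup.
have [k ek] := p_natP pi; move: le_p; rewrite ek pfactorK // -{2}(expn1 p).
by rewrite leq_exp2l ?(prime_gt1 p_pr).
Qed.

(* With [D] of index [p] in the cyclic group ['Phi(W)], every element not
   centralising [D] has its [p]-th power in [D] and so generates with [D] a
   noncyclic cover of [D]: there is no room for more than two of those. *)
Lemma K33_free_Phi_center (gT : finGroupType) (G W : {group gT}) (p : nat) c :
  K33_free G -> W \subset G -> p.-group W -> ~~ cyclic W -> 'Phi(W) = <[c]> ->
  c ^+ p \in 'Z(W).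
Proof.
move=> freeG sWG pW ncW eP.
have ntW : W :!=: 1 by apply: contraNneq ncW => ->; apply: cyclic1.
have [p_pr _ _] := pgroup_pdiv pW ntW; have p_gt1 := prime_gt1 p_pr.
have Wc : c \in W by rewrite -cycle_subG -eP Phi_sub.
pose D := <[c ^+ p]>%G; have sDP : D \subset 'Phi(W) by rewrite eP cycleX.
have sDW : D \subset W := subset_trans sDP (Phi_sub W).
have nDW : W \subset 'N(D).
  apply: normal_norm; apply: char_normal_trans (Phi_normal W).
  by rewrite sub_cyclic_char //= eP cycle_cyclic.
rewrite inE groupX //= -cycle_subG; apply/negPn/negP=> ncD.
have ntD : D :!=: 1 by apply: contraNneq ncD => /= ->; apply: sub1G.
have p_dv : p %| #[c].
  have pc : p.-group <[c]> by rewrite -eP (pgroupS (Phi_sub W)).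
  case/pgroup_pdiv: pc => //.
  by apply: contraNneq ntD => ec; rewrite -subG1 /= -ec cycleX.
pose C := 'C_W(D)%G; have sCW : C \subset W := subsetIl _ _.
have := @K33_free_noncyclic_covers _ G D (W :\: C) p freeG ntD p_pr (subset_trans sDW sWG).
move=> /(_ _)/wrap[] => [w /setDP[Ww nCw] | ].
  have ncw : w \notin 'C(D) by apply: contra nCw => cw; rewrite inE Ww.
  have nDw : w \notin D.
    apply: contra ncw; apply: (subsetP _ w); rewrite -abelianE; exact: cycle_abelian.
  have Dwp : w ^+ p \in D.
    have : w ^+ p \in <[c]> by rewrite -eP p_expg_Phi.
    case/cycleP=> k ek; have [/dvdnP[m em] | ndv] := boolP (p %| k).
      by rewrite ek em mulnC expgM groupX ?cycle_id.
    (* If [p] does not divide [k], then [w ^ p] generates [<c>], so [w] centralises [<c>] and with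
       it [D], a contradiction. *)
    have gen : generator <[c]> (w ^+ p).
      rewrite ek generator_coprime; rewrite coprime_sym.
      have : p.-nat #[c] by rewrite orderE -eP; apply: (pgroupS (Phi_sub W) pW).
      by case/p_natP=> n ->; rewrite coprimeXr // coprime_sym prime_coprime.
    case/negP: ncw; apply: (subsetP _ w (cycle_id w)).
    apply: centSS (subxx _) _ (cycle_abelian w).
    apply: subset_trans (cycleX c p) _.
    by have /eqP-> := gen; apply: cycleX.
  split=> //; first exact: (subsetP sWG); first exact: (subsetP nDW).
  apply: contra ncw => /cyclic_abelian abX.
  have Xw : w \in D <*> <[w]> by rewrite -cycle_subG joing_subr.
  by apply: subsetP Xw; apply: subset_trans abX (centS (joing_subl _ _)).
(* From [|W : C| >= p] and [|W| >= p ^ 2 |'Phi(W)| = p ^ 3 |D|] it follows that [W] has at least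
   [(p - 1) p ^ 2 |D|] elements outside [C], more than [2 (p - 1) |D|]. *)
rewrite leqNgt; case/negP.
have iC : p <= #|W : C|.
  have [eC | [M maxM sCM]] := maximal_exists sCW.
    by case/negP: ncD; rewrite centsC -eC subsetIr.
  by rewrite -(p_maximal_index pW maxM) dvdn_leq // indexgS.
have oP : #|'Phi(W)| = (p * #|D|)%N.
  by rewrite eP -!orderE orderXdiv // mulnC divnK.
have oW : p ^ 2 <= #|W : 'Phi(W)|.
  have pi : p.-nat #|W : 'Phi(W)|.
    by rewrite -card_quotient ?normal_norm ?Phi_normal // -pgroupE quotient_pgroup.
  have [k ek] := p_natP pi; rewrite ek leq_exp2l // ltnNge; apply: contra ncW => k_le1.
  apply: Phi_quotient_cyclic; rewrite (abelem_cyclic (Phi_quotient_abelem pW)).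
  by rewrite card_quotient ?normal_norm ?Phi_normal // ek pfactorK.
have := Lagrange (Phi_sub W); rewrite oP => eW.
have := Lagrange sCW => eW'.
rewrite cardsD (setIidPr sCW) ltn_subRL.
have d_gt0 : 0 < #|D| := cardG_gt0 D.
move: oW iC eW eW' d_gt0 p_gt1; rewrite expnS expn1.
move: #|W : C| #|W| #|W : _| #|C| #|D|; clear => i w j cc d le_j le_i ew ew' d_gt0 p_gt1.
have le_w : p * cc <= w by rewrite -ew' mulnC leq_mul2l le_i orbT.
have lt_w : 2 * (p * d) < w.
  rewrite -ew mulnC ltn_pmul2l ?muln_gt0 ?d_gt0 ?(ltnW p_gt1) //.
  by apply: leq_trans le_j; apply: (@leq_trans (2 * 2)) => //; apply: leq_mul.
rewrite -(ltn_pmul2l (ltnW p_gt1)) mulnDr.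
apply: (@leq_trans (w + p.-1 * w)); last by rewrite -mulSn prednK // ltnW.
rewrite -addnS leq_add //.
have -> : (p * (2 * (p.-1 * d)) = p.-1 * (2 * (p * d)))%N by move: p.-1 => q; lia.
by rewrite ltn_pmul2l // -ltnS prednK // ltnW.
Qed.

(** The constant is [p ^ 3] for [W / 'Phi(W)] times [p] for the step from [<c>] to [<c ^ p>], which
    is central in [W] and so contained in [E]. *)
Lemma K33_free_pgroup_bound (gT : finGroupType) (G W E : {group gT}) (p : nat) :
  K33_free G -> W \subset G -> p.-group W -> E \subset W -> ~~ abelian E ->
  #|W| <= p ^ 4 * #|E|.
Proof.
move=> freeG sWG pW sEW nabE.
have ncW : ~~ cyclic W.
  by apply: contra nabE => /cyclic_abelian; apply: abelianS.
have ntW : W :!=: 1 by apply: contraNneq ncW => ->; apply: cyclic1.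
have [p_pr _ _] := pgroup_pdiv pW ntW.
have /cyclicP[c eP] := K33_free_Phi_cyclic freeG sWG pW ncW.
have Zcp := K33_free_Phi_center freeG sWG pW ncW eP.
have Ecp : c ^+ p \in E.
  apply: (subsetP (K33_free_cent_nonabelian (K33_freeS sWG freeG) sEW nabE)).
  case/setIP: Zcp => Wcp cW; rewrite inE Wcp; exact: (subsetP (centS sEW)).
have oc : #[c] <= p * #|E|.
  have : #[c ^+ p] <= #|E| by rewrite orderE subset_leq_card // cycle_subG.
  rewrite orderXgcd => le_c; rewrite -(divnK (dvdn_gcdl #[c] p)) mulnC.
  by apply: leq_mul => //; apply: dvdn_leq (dvdn_gcdr _ _); apply: prime_gt0.
rewrite -(Lagrange (Phi_sub W)) mulnC expnSr -mulnA leq_mul //.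
  exact: K33_free_Phi_index freeG sWG pW p_pr.
by rewrite /= eP -orderE.
Qed.

(** * Noncyclic Sylow subgroups *)

Section NoncyclicSylow.

Variables (gT : finGroupType) (Y : {group gT}) (p : nat).

(** [Y] is a minimal counterexample: normality fails for its own Sylow [p]-subgroups, but holds for
    noncyclic ones of proper subgroups and proper quotients. *)
Hypothesis p_pr : prime p.
Hypothesis freeY : K33_free Y.
Hypothesis sub_normal : forall X S : {group gT},
  X \proper Y -> p.-Sylow(X) S -> ~~ cyclic S -> S <| X.
Hypothesis quo_normal : forall (Z : {group gT}) (S : {group coset_of Z}),
  Z <| Y -> Z :!=: 1 -> p.-Sylow(Y / Z) S -> ~~ cyclic S -> S <| Y / Z.
Hypothesis Sylow_noncyclic : forall P : {group gT}, p.-Sylow(Y) P -> ~~ cyclic P.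
Hypothesis Sylow_nonnormal : forall P : {group gT}, p.-Sylow(Y) P -> ~~ (P <| Y).

Implicit Types (P Q R S X : {group gT}) (i j : three).

Lemma Sylow_sub_eq P Q : p.-Sylow(Y) P -> p.-Sylow(Y) Q -> P \subset Q -> P = Q.
Proof.
move=> sylP sylQ sPQ; apply/val_inj/eqP.
by rewrite eqEcard sPQ (card_Hall sylP) (card_Hall sylQ) leqnn.
Qed.

(** Take distinct Sylow subgroups with largest intersection [D]. If [D] is not normal in [Y], a
    Sylow subgroup [S] of the proper subgroup ['N_Y(D)] is normal there and contains both ['N_P1(D)]
    and ['N_P2(D)]. A Sylow subgroup of [Y] over [S] then meets [P1] and [P2] in more than [D], so
    it equals both. *)
Lemma Sylow_meet P Q : p.-Sylow(Y) P -> p.-Sylow(Y) Q -> P != Q -> P :&: Q = 'O_p(Y).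
Proof.
pose T := [pred u : {group gT} * {group gT} |
  [&& p.-Sylow(Y) u.1, p.-Sylow(Y) u.2 & u.1 != u.2]].
move=> sylP sylQ nePQ; have Tu0 : T (P, Q) by rewrite /= sylP sylQ.
case: (@arg_maxnP _ (P, Q) T (fun u => #|u.1 :&: u.2|) Tu0) => -[P1 P2] /=.
case/and3P=> sylP1 sylP2 neP12 max12.
pose D := (P1 :&: P2)%G.
have pP1 := pHall_pgroup sylP1; have pP2 := pHall_pgroup sylP2.
have pD : p.-group D := pgroupS (subsetIl _ _) pP1.
have sDY : D \subset Y := subset_trans (subsetIl _ _) (pHall_sub sylP1).
suff nDY : Y \subset 'N(D).
  have sDO : D \subset 'O_p(Y) by rewrite pcore_max // /normal sDY.
  apply/esym/eqP; rewrite eqEcard subsetI !pcore_sub_Hall //=.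
  apply: leq_trans (subset_leq_card sDO); apply: (max12 (P, Q)).
  by rewrite /= sylP sylQ.
apply: contraT => nnDY; pose N := 'N_Y(D)%G.
have ltNY : N \proper Y by rewrite properE subsetIl subsetI subxx.
have grow R : p.-Sylow(Y) R -> D \proper R ->
    [/\ D \proper 'N_R(D), p.-group 'N_R(D) & 'N_R(D) \subset N].
  move=> sylR ltDR; have pR := pHall_pgroup sylR; split.
  - exact: nilpotent_proper_norm (pgroup_nil pR) ltDR.
  - exact: pgroupS (subsetIl _ _) pR.
  by rewrite setSI ?(pHall_sub sylR).
have ltD1 : D \proper P1.
  rewrite properE subsetIl subsetI subxx /=; apply: contra neP12 => sP12.
  by apply/eqP/Sylow_sub_eq.
have ltD2 : D \proper P2.
  rewrite properE subsetIr subsetI subxx andbT; apply: contra neP12 => sP21.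
  by apply/eqP/esym/Sylow_sub_eq.
have [lt1 p1 s1] := grow P1 sylP1 ltD1; have [lt2 p2 s2] := grow P2 sylP2 ltD2.
have [S sylS sN1S] := Sylow_superset s1 p1.
have pS := pHall_pgroup sylS; have sSN := pHall_sub sylS.
(* For cyclic [S], [D] is characteristic in ['N_P1(D)], which is then its own normaliser in [P1];
   hence [P1] would be cyclic. *)
have [cS | ncS] := boolP (cyclic S).
  have cN1 : cyclic 'N_P1(D) := cyclicS sN1S cS.
  have sDN1 : D \subset 'N_P1(D) := proper_sub lt1.
  have chD : D \char 'N_P1(D) by rewrite sub_cyclic_char.
  have eN1 : P1 :=: 'N_P1(D).
    apply: nilpotent_sub_norm (pgroup_nil pP1) (subsetIl _ _) _.
    by rewrite setIS //; apply: char_norms.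
  by case/negP: (Sylow_noncyclic sylP1); rewrite eN1.
have nSN := sub_normal ltNY sylS ncS.
have sN2S : 'N_P2(D) \subset S by rewrite (sub_normal_Hall sylS nSN).
have [P3 sylP3 sSP3] := Sylow_superset (subset_trans sSN (subsetIl _ _)) pS.
have eq3 R : p.-Sylow(Y) R -> D \proper 'N_R(D) -> 'N_R(D) \subset S -> P3 = R.
  move=> sylR ltR sRS; apply: contraTeq ltR => neP; apply/negP=> /proper_card.
  have leD : #|P3 :&: R| <= #|D| by apply: (max12 (P3, R)); rewrite /= sylP3 sylR.
  rewrite ltnNge (leq_trans _ leD) // subset_leq_card // subsetI.
  by rewrite (subset_trans sRS sSP3) subsetIl.
by case/eqP: neP12; rewrite -(eq3 P1) // (eq3 P2).
Qed.

Lemma three_Sylows : exists P : three -> {group gT},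
  (forall i, p.-Sylow(Y) (P i)) /\ forall i j, P i = P j -> i = j.
Proof.
have [P0 sylP0] := Sylow_exists p Y.
have : 2 < #|'Syl_p(Y)|.
  have := card_Syl_mod Y p_pr; have := prime_gt1 p_pr.
  have : #|'Syl_p(Y)| != 1%N.
    rewrite (card_Syl sylP0) indexg_eq1 subsetI subxx; apply: contra (Sylow_nonnormal sylP0).
    by rewrite /normal (pHall_sub sylP0).
  case: #|_| => [|[|[|n]]] // _ p_gt1; first by rewrite mod0n.
  move: p_gt1; rewrite leq_eqVlt => /predU1P[<- // | p_gt2].
  by rewrite modn_small.
case/card_gt2P=> P1 [P2 [P3 [[/[!inE] sylP1 sylP2 sylP3] [/eqP n12 /eqP n23 /eqP n31]]]].
exists (triple P1 P2 P3); split; first by case.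
by apply: triple_inj => // e; apply: n31.
Qed.

(** A noncyclic [D = 'O_p(Y)] has only noncyclic covers. If [D] is cyclic, let [Z] be its subgroup
    of order [p]: minimality makes [P / Z] cyclic, hence [P] abelian as [Z] is central. The
    noncyclic [P] then has an element [a] of order [p] outside [D], and [D <a>] has two subgroups of
    order [p]. *)
Lemma pcore_noncyclic_cover P : p.-Sylow(Y) P -> 'O_p(Y) != 1 ->
  exists N : {group gT}, [/\ maximal 'O_p(Y) N, N \subset P & ~~ cyclic N].
Proof.
move=> sylP ntD; pose D := 'O_p(Y)%G; have pP := pHall_pgroup sylP.
have sDP : D \subset P := pcore_sub_Hall sylP.
have nDP : P \subset 'N(D).
  exact: subset_trans (pHall_sub sylP) (normal_norm (pcore_normal p Y)).
have [cD | ncD] := boolP (cyclic D); last first.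
  have [||X [N [maxX sDX sNP sXD _]]] := @chain_step _ (fun X => X \subset D) D P sDP.
  - exact: subxx.
  - move=> sPD; case/negP: (Sylow_nonnormal sylP).
    have -> : P :=: D by apply/eqP; rewrite eqEsubset sPD.
    exact: pcore_normal.
  have eX : X = D by apply/val_inj/eqP; rewrite eqEsubset sXD.
  exists N; split=> //; first by rewrite -[X in maximal X _]/(gval D) -eX.
  apply: contra ncD; apply: cyclicS; apply: subset_trans sDX (maximal_sub maxX).
have pD : p.-group D := pcore_pgroup p Y.
have [_ p_dvD _] := pgroup_pdiv pD ntD.
have [z Dz oz] := Cauchy p_pr p_dvD.
pose Z := <[z]>%G; have sZD : Z \subset D by rewrite cycle_subG.
have nsZY : Z <| Y.
  by apply: char_normal_trans (pcore_normal p Y); rewrite sub_cyclic_char.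
have ntZ : Z :!=: 1 by rewrite -cardG_gt1 /= -orderE oz prime_gt1.
have nZP : P \subset 'N(Z) := subset_trans (pHall_sub sylP) (normal_norm nsZY).
have sylPZ : p.-Sylow(Y / Z) (P / Z) by apply: quotient_pHall.
have cPZ : cyclic (P / Z).
  apply: contraT => ncPZ; case/negP: (Sylow_nonnormal sylP).
  have := quo_normal nsZY ntZ sylPZ ncPZ.
  rewrite -(cosetpre_normal) !quotientGK //.
  by rewrite /normal (subset_trans sZD).
have sZZ : Z \subset 'Z(P).
  apply: prime_meetG; first by rewrite /= -orderE oz.
  apply: meet_center_nil (pgroup_nil pP) _ ntZ.
  by rewrite /normal (subset_trans sZD).
have abP : abelian P := cyclic_factor_abelian sZZ cPZ.
have /subsetPn[a Oa nDa] : ~~ ('Ohm_1(P) \subset D).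
  apply/negP=> sOD; case/negP: (Sylow_noncyclic sylP).
  have cO := cyclicS sOD cD; rewrite abelian_rank1_cyclic // -rank_Ohm1.
  by rewrite -abelian_rank1_cyclic ?cyclic_abelian.
have Pa : a \in P := subsetP (Ohm_sub 1 P) a Oa.
have ap : a ^+ p = 1.
  by have /abelemP[//| _ ->] := Ohm1_abelem pP abP.
have nDa' : a \in 'N(D) := subsetP nDP a Pa.
have [|maxD _] := maximal_joing_cycle p_pr nDa' _ nDa; first by rewrite ap.
exists (D <*> <[a]>)%G; split=> //; first by rewrite join_subG sDP cycle_subG.
have oa : #[a] = p by apply: nt_prime_order => //; apply: contraNneq nDa => ->.
apply/negP=> cN; case/negP: nDa; apply: (subsetP sZD).
have eaz : <[a]> :==: Z.
  rewrite (eq_subG_cyclic cN (joing_subr _ _)) -?orderE ?oa ?oz //.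
  exact: subset_trans sZD (joing_subl _ _).
by rewrite -cycle_subG (eqP eaz).
Qed.

(** Otherwise three Sylow subgroups supply three noncyclic covers of ['O_p(Y)], distinct because
    these Sylow subgroups meet pairwise in ['O_p(Y)]. *)
Lemma pcore_Sylow_TI P Q : p.-Sylow(Y) P -> p.-Sylow(Y) Q -> P != Q -> P :&: Q = 1.
Proof.
move=> sylP sylQ nePQ; rewrite Sylow_meet //; apply/eqP; apply: contraT => ntD.
have [S [sylS injS]] := three_Sylows.
have [N NP] := choice _ (fun i => pcore_noncyclic_cover (sylS i) ntD).
case: freeY; apply: (K33_noncyclic_covers (D := 'O_p(Y)%G) (N := N)) => //.
- by move=> i; have [_ sNS _] := NP i; apply: subset_trans sNS (pHall_sub (sylS i)).
- by move=> i; have [] := NP i.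
- by move=> i; have [] := NP i.
move=> i j eN; apply: injS; apply/eqP; apply: contraT => neS.
have [maxD sNi _] := NP i; have [_ sNj _] := NP j; rewrite -eN in sNj.
have := maximal_ltn (M := 'O_p(Y)%G) maxD; rewrite ltnNge subset_leq_card //=.
by rewrite -(Sylow_meet (sylS i) (sylS j) neS) subsetI sNi.
Qed.

Lemma normaliser_Sylow_maximal P : p.-Sylow(Y) P -> maximal 'N_Y(P) Y.
Proof.
move=> sylP; have sPY := pHall_sub sylP; apply/maxgroupP; split=> [|X ltXY sNX].
  rewrite properE subsetIl subsetI subxx /=.
  by apply: contra (Sylow_nonnormal sylP); rewrite /normal sPY.
have sPX : P \subset X by apply: subset_trans sNX; rewrite subsetI sPY normG.
have sXY := proper_sub ltXY.
have sylPX : p.-Sylow(X) P := pHall_subl sPX sXY sylP.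
have := normal_norm (sub_normal ltXY sylPX (Sylow_noncyclic sylP)) => nPX.
by apply/eqP; rewrite eqEsubset sNX subsetI sXY nPX.
Qed.

Lemma normaliser_Sylow_TI P Q : p.-Sylow(Y) P -> p.-Sylow(Y) Q -> P != Q ->
  'N_Y(P) :&: Q = 1.
Proof.
move=> sylP sylQ nePQ; apply/trivgP; rewrite -(pcore_Sylow_TI sylP sylQ nePQ).
rewrite subsetI subsetIr andbT.
have sPN : P \subset 'N_Y(P) by rewrite subsetI (pHall_sub sylP) normG.
have sylPN : p.-Sylow('N_Y(P)) P := pHall_subl sPN (subsetIl _ _) sylP.
have nPN : P <| 'N_Y(P) by rewrite /normal sPN subsetIr.
by rewrite (sub_normal_Hall sylPN nPN) ?subsetIl // (pgroupS (subsetIr _ _)) ?(pHall_pgroup sylQ).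
Qed.

Lemma Sylow_prime_subgroup P : p.-Sylow(Y) P ->
  exists A : {group gT}, A \subset P /\ prime #|A|.
Proof.
move=> sylP; have ntP : P :!=: 1.
  by apply: contraNneq (Sylow_noncyclic sylP) => ->; apply: cyclic1.
have [_ p_dv _] := pgroup_pdiv (pHall_pgroup sylP) ntP.
have [a Pa oa] := Cauchy p_pr p_dv.
by exists <[a]>%G; rewrite cycle_subG Pa -orderE oa.
Qed.

Lemma prime_subgroup_private P Q (A : {group gT}) :
  p.-Sylow(Y) P -> p.-Sylow(Y) Q -> P != Q -> A \subset P -> prime #|A| ->
  ~~ (A \subset 'N_Y(Q)).
Proof.
move=> sylP sylQ nePQ sAP prA; apply: contraL prA => sAN.
have : A \subset 'N_Y(Q) :&: P by rewrite subsetI sAN.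
by rewrite normaliser_Sylow_TI // 1?eq_sym // => /trivGP->; rewrite cards1.
Qed.

Lemma normaliser_Sylow_meet3 (P : three -> {group gT}) :
  (forall i, p.-Sylow(Y) (P i)) -> (forall i j, P i = P j -> i = j) ->
  'N_Y(P t0) :&: 'N_Y(P t1) :&: 'N_Y(P t2) = 1.
Proof.
move=> sylP injP; set I := _ :&: _.
have [A AP] := choice _ (fun i => Sylow_prime_subgroup (sylP i)).
have neP i j : i <> j -> P i != P j by move=> neq; apply/eqP=> /injP.
have sIN i : I \subset 'N_Y(P i).
  by case: i; rewrite /I; [rewrite -setIA | rewrite setIAC|]; rewrite ?subsetIl ?subsetIr //;
    rewrite -setIA setICA subsetIl.
apply/eqP; apply: contraT => ntI; case: freeY.
apply: (K33_common_element (X0 := ('N_Y(P t0) :&: 'N_Y(P t1) :&: 'N_Y(P t2))%G)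
  (N := fun i => 'N_Y(P i)%G) (A := A)) => //.
- by move=> i; apply: normaliser_Sylow_maximal.
- move=> i; have [sAP _] := AP i; rewrite subsetI; apply/andP; split.
    exact: subset_trans sAP (pHall_sub (sylP i)).
  exact: subset_trans sAP (normG _).
- by move=> i; have [] := AP i.
- move=> i j /neP neq; have [sAP prA] := AP i.
  exact: prime_subgroup_private (sylP i) (sylP j) neq sAP prA.
Qed.

(** Conjugating [Q] by three elements of [P] gives distinct Sylow subgroups [R i], since [P] meets
    ['N_Y(Q)] trivially. If the intersection is nontrivial, ['N_Y(P)] meets every ['N_Y(R i)] in a
    conjugate of it, while triple intersections vanish: this is the configuration of
    [K33_common_neighbour]. *)
Lemma normaliser_Sylow_meet P Q : p.-Sylow(Y) P -> p.-Sylow(Y) Q -> P != Q ->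
  'N_Y(P) :&: 'N_Y(Q) = 1.
Proof.
move=> sylP sylQ nePQ; apply/eqP; apply: contraT => ntI.
have : 2 < #|P|.
  rewrite ltnNge; apply: contra (Sylow_noncyclic sylP) => leP.
  by apply: cyclic_small; apply: leqW.
case/card_gt2P=> x [y [z [[Px Py Pz] [nxy nyz nzx]]]].
pose u := triple x y z; have Pu i : u i \in P by case: i.
have Yu i : u i \in Y := subsetP (pHall_sub sylP) _ (Pu i).
pose R i := (Q :^ u i)%G; have sylR i : p.-Sylow(Y) (R i) by rewrite pHallJ.
have neRP i : P != R i.
  apply: contra nePQ => /eqP eP; apply/eqP/val_inj.
  by apply: (@conjsg_inj _ (u i)); rewrite conjGid // {1}eP.
have injR i j : R i = R j -> i = j.
  move=> eR; have eu : u i = u j.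
    have : u i * (u j)^-1 \in 'N_Y(Q) :&: P.
      apply/setIP; split; last by rewrite groupM ?groupV.
      apply/setIP; split; first by rewrite groupM ?groupV.
      by apply/normP; rewrite conjsgM -[Q :^ u i]/(gval (R i)) eR /= conjsgK.
    rewrite normaliser_Sylow_TI // 1?eq_sym // => /set1P/eqP.
    by rewrite -eq_mulgV1 => /eqP.
  by case: i j eu {eR} => [] [] //= /eqP; rewrite ?(negPf nxy) ?(negPf nyz) ?(negPf nzx) //
    eq_sym ?(negPf nxy) ?(negPf nyz) ?(negPf nzx).
have neR i j : i <> j -> R i != R j by move=> neq; apply/eqP=> /injR.
have [A AP] := choice _ (fun i => Sylow_prime_subgroup (sylR i)).
case: freeY.
apply: (K33_common_neighbour (N0 := 'N_Y(P)%G) (N := fun i => 'N_Y(R i)%G) (A := A)) => //.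
- exact: normaliser_Sylow_maximal.
- by move=> i; apply: normaliser_Sylow_maximal.
- move=> i; have [sAR _] := AP i; rewrite subsetI; apply/andP; split.
    exact: subset_trans sAR (pHall_sub (sylR i)).
  exact: subset_trans sAR (normG _).
- by move=> i; have [] := AP i.
- move=> i j /neR neq; have [sAR prA] := AP i.
  exact: prime_subgroup_private (sylR i) (sylR j) neq sAR prA.
- move=> i; have [sAR prA] := AP i; apply: prime_subgroup_private (sylR i) sylP _ sAR prA.
  by rewrite eq_sym.
- move=> i /=; have -> : 'N_Y(P) :&: 'N_Y(Q :^ u i) = ('N_Y(P) :&: 'N_Y(Q)) :^ u i.
    by rewrite !conjIg -!normJ (conjGid (Yu i)) (conjGid (Pu i)).
  by rewrite -(conjs1g (u i)) (inj_eq (@conjsg_inj _ (u i))).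
move=> i j neq /=; pose S := triple P (R i) (R j).
have sylS k : p.-Sylow(Y) (S k) by case: k; [apply: sylP | apply: sylR | apply: sylR].
have injS k l : S k = S l -> k = l.
  by case: k l => [] [] //= /eqP; rewrite ?(negPf (neRP _)) ?(negPf (neR _ _ neq)) //
    eq_sym ?(negPf (neRP _)) ?(negPf (neR _ _ neq)).
exact: normaliser_Sylow_meet3 sylS injS.
Qed.

(* The normalisers of the Sylow [p]-subgroups are Frobenius complements, and
   a noncyclic [p]-group cannot act on the Frobenius kernel. *)
Lemma noncyclic_Sylow_contradiction : False.
Proof.
have [P sylP] := Sylow_exists p Y; have pP := pHall_pgroup sylP.
have sPY := pHall_sub sylP; pose N := 'N_Y(P)%G.
have sPN : P \subset N by rewrite subsetI sPY normG.
have ntP : P :!=: 1.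
  by apply: contraNneq (Sylow_noncyclic sylP) => ->; apply: cyclic1.
have ntN : N :!=: 1 by apply: contraNneq ntP => eN; rewrite -subG1 -eN.
have frob : [Frobenius Y with complement N].
  apply/andP; split; first exact: proper_neq (maxgroupp (normaliser_Sylow_maximal sylP)).
  apply/normedTI_P; split; first by rewrite setD_eq0 subG1.
    by rewrite subsetI subsetIl normsD1 ?normG.
  move=> g Yg /exists_inP[x /setD1P[ntx Nx]]; rewrite conjD1g => /setD1P[_ Nxg].
  apply/setIP; split=> //; apply/normP/eqP.
  apply: contraT => neP; have sylPg : p.-Sylow(Y) (P :^ g) by rewrite pHallJ.
  have neP' : P != (P :^ g)%G by rewrite eq_sym.
  case/eqP: ntx; apply/set1P; rewrite -[[set 1]]/(1 : {set gT}).
  rewrite -(normaliser_Sylow_meet sylP sylPg neP'); apply/setIP; split=> //.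
  by move: Nxg; rewrite conjIg -normJ (conjGid Yg).
have [K frobK] := Frobenius_kernel_exists frob.
have [defY ntK _ _ _] := Frobenius_context frobK.
have [_ _ nKN _] := sdprodP defY; have coKN := Frobenius_coprime frobK.
have p'K : p^'.-group K.
  rewrite p'groupEpi; apply: contraL coKN; rewrite mem_primes => /and3P[_ _ p_dvK].
  have [_ p_dvP _] := pgroup_pdiv pP ntP.
  have p_dvN : p %| #|N| := dvdn_trans p_dvP (cardSg sPN).
  rewrite /coprime; apply/eqP=> gcd1; have := dvdn_gcd p #|K| #|N|.
  by rewrite gcd1 p_dvK p_dvN dvdn1 gtn_eqF ?prime_gt1.
have sKY : K \subset Y by have [/andP[]] := sdprod_context defY.
case/eqP: ntK; apply: K33_noncyclic_norm_p' freeY sPY sKY pP _ p'K _.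
  exact: Sylow_noncyclic sylP.
exact: subset_trans sPN nKN.
Qed.

End NoncyclicSylow.

(** The induction on the order generalises the ambient type, because minimality is applied to
    quotients as well. *)
Theorem K33_free_noncyclic_Sylow_normal (gT : finGroupType) (Y P : {group gT}) (p : nat) :
  K33_free Y -> p.-Sylow(Y) P -> ~~ cyclic P -> P <| Y.
Proof.
have [n] := ubnP #|Y|; elim: n => // n IHn in gT Y P * => /ltnSE-leYn freeY sylP ncP.
have ntP : P :!=: 1 by apply: contraNneq ncP => ->; apply: cyclic1.
have [p_pr p_dvP _] := pgroup_pdiv (pHall_pgroup sylP) ntP.
apply: contraT => nnP; exfalso; apply: (@noncyclic_Sylow_contradiction gT Y p p_pr freeY).
- move=> X S ltXY; apply: IHn (K33_freeS (proper_sub ltXY) freeY).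
  exact: leq_trans (proper_card ltXY) leYn.
- move=> Z S nsZY ntZ; apply: IHn (K33_free_quotient nsZY freeY).
  apply: leq_trans leYn; rewrite card_quotient ?normal_norm // -divgS ?normal_sub //.
  by rewrite ltn_Pdiv ?cardG_gt0 // cardG_gt1.
- by move=> Q sylQ; have [x _ ->] := Sylow_trans sylP sylQ; rewrite cyclicJ.
move=> Q sylQ; have [x Yx ->] := Sylow_trans sylP sylQ.
by rewrite -(conjGid Yx) normalJ.
Qed.

(** * Groups with cyclic Sylow subgroups *)

(* On [S] the transfer into [S] is the power map with exponent [#|G : S|], so
   its kernel is a normal complement of [S]. *)
Lemma Burnside_normal_complement (gT : finGroupType) (G S : {group gT}) (p : nat) :
  p.-Sylow(G) S -> 'N_G(S) \subset 'C(S) ->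
  exists K : {group gT}, K <| G /\ p^'.-Hall(G) K.
Proof.
move=> sylS cSN; have [sSG pS _] := and3P sylS.
have abS : abelian S by apply: subset_trans cSN; rewrite subsetI sSG normG.
have abA : abelian (idm S @* S) by rewrite morphim_idm.
have coS : coprime #|S| #|G : S|.
  by have := pnat_coprime pS; apply; case/and3P: sylS.
(* Burnside's fusion argument: [S] and [S :^ y] are Sylow subgroups of the centraliser of [x ^ y],
   hence conjugate there by some [z]; then [y * z] normalises [S] and so centralises [x]. *)
have fusion x y : x \in S -> y \in G -> x ^ y \in S -> x ^ y = x.
  move=> Sx Gy Sxy; pose C := 'C_G[x ^ y]%G.
  have sylSC (R : {group gT}) : p.-Sylow(G) R -> abelian R -> x ^ y \in R -> p.-Sylow(C) R.
    move=> sylR abR Rxy; apply: (pHall_subl _ (subsetIl _ _) sylR).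
    rewrite subsetI (pHall_sub sylR) /=; apply: subset_trans abR _.
    by rewrite -cent_set1 centS // sub1set.
  have sylSy : p.-Sylow(C) (S :^ y) by apply: sylSC; rewrite ?pHallJ ?abelianJ ?memJ_conjg.
  have [z Cz eS] := Sylow_trans sylSy (sylSC S sylS abS Sxy).
  have [Gz cz] := setIP Cz.
  have Nyz : y * z \in 'N_G(S).
    by rewrite inE groupM //=; apply/normP; rewrite conjsgM -eS.
  have := centP (subsetP cSN _ Nyz) x Sx => cyz.
  have -> : x ^ y = x ^ (y * z).
    by rewrite conjgM; apply/esym/conjg_fixP/commgP/commute_sym/cent1P.
  by apply/conjg_fixP/commgP/commute_sym.
pose f := transfer_morphism G abA.
have fS g : g \in S -> f g = 1 -> g = 1.
  move=> Sg fg1; have Gg := subsetP sSG g Sg.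
  have trX := transversalP (rcosets_cycle_partition sSG Gg).
  have Ag : g \in idm S @* S by rewrite morphim_idm.
  have := transfer_cycle_expansion sSG abA Gg trX.
  rewrite (eq_bigr (fun x => fmod abA g *+ #|<[g]> : S :* x|)%R) => [|x Xx].
    rewrite GRing.sumrMnr (sum_index_rcosets_cycle sSG Gg trX) -fmodX //.
    rewrite -[LHS]/(f g) fg1 => /congr_fmod/esym; rewrite fmodK ?groupX // => gm.
    by rewrite -(expgK coS Sg) gm expg1n.
  have Gx : x \in G := subsetP (transversal_sub trX) x Xx.
  have Sgx : (g ^+ #|<[g]> : S :* x|) ^ x^-1 \in S.
    by rewrite conjgE invgK mulgA -mem_rcoset mulg_exp_card_rcosets.
  by rewrite -fmodX //= /restrm /= /idm fusion ?groupX ?groupV.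
have nsKG : 'ker f <| G := ker_normal _.
exists ('ker f)%G; split=> //.
have p'K : p^'.-group ('ker f).
  have sylK := Sylow_setI_normal nsKG sylS.
  have tiSK : S :&: 'ker f = 1.
    by apply/trivgP/subsetP=> g /setIP[Sg /mker fg]; apply/set1P/fS.
  by rewrite -partG_eq1 -(card_Hall sylK) /= setIC tiSK cards1 eqxx.
apply/and3P; split; rewrite ?normal_sub // pnatNK.
(* The image of [f] has exponent dividing [|S|], so only [p] can divide the index of the kernel. *)
have <- : #|f @* G| = #|G : 'ker f| by rewrite card_morphim setIid.
apply/pgroupP=> q q_pr /(Cauchy q_pr)[u _ ou].
have uS : u ^+ #|S| = 1.
  rewrite FinRing.Theory.zmodXgE; apply: fmod_inj; rewrite fmvalZ.
  by apply: expg_cardG; have := fmodP u; rewrite /= morphim_idm.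
apply: (pgroupP pS) => //; first by rewrite -ou order_dvdn uS.
Qed.

Lemma p'_cent_noncyclic (gT : finGroupType) (G P : {group gT}) (p : nat) y :
  K33_free G -> P \subset G -> p.-group P -> ~~ cyclic P ->
  y \in 'C_G(P) -> p^'.-elt y -> y = 1.
Proof.
move=> freeG sPG pP ncP /setIP[Gy cPy] p'y.
apply/set1P; rewrite -[[set 1]]/(1 : {set gT}) -(cycle_subG y 1) subG1; apply/eqP.
apply: (K33_noncyclic_norm_p' freeG sPG _ pP ncP p'y); first by rewrite cycle_subG.
by apply: cents_norm; rewrite centsC cycle_subG.
Qed.

Lemma p_elements_pgroup (gT : finGroupType) (G : {group gT}) (p : nat) :
  (forall y, y \in G -> p^'.-elt y -> y = 1) -> p.-group G.
Proof.
move=> HG; apply/pgroupP=> q q_pr /(Cauchy q_pr)[y Gy oy].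
apply: contraT => neq; have y1 : y = 1.
  by apply: HG => //; rewrite /p_elt oy pnatE.
by rewrite y1 order1 in oy; rewrite -oy in q_pr.
Qed.

Lemma card_norm_cent_fact (gT : finGroupType) (F P : {group gT}) :
  F \subset 'N(P) -> #|F| <= #|'C_F(P)| * (#|P|)`!.
Proof.
move=> nPF; rewrite -(LagrangeI F 'C(P)) leq_mul2l; apply/orP; right.
have <- : #|conj_aut P @* F| = #|F : 'C(P)|.
  by rewrite card_morphim ker_conj_aut (setIidPr nPF).
rewrite -card_perm; apply: subset_leq_card; apply: subset_trans (Aut_conj_aut P F) _.
by apply/subsetP=> a; rewrite inE => /andP[].
Qed.

(** The second summand serves the case ['Phi(P) = 1], where [|P| <= p ^ 3], ['C_F(P)] lies in [P],
    and [F / 'C_F(P)] permutes [P] faithfully. The first serves the case where [F] is a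
    [p]-group. *)
Theorem K33_free_noncyclic_bound (gT : finGroupType) (F E P : {group gT}) (p : nat) :
  K33_free F -> E \subset F -> ~~ abelian E -> p.-Sylow(F) P -> ~~ cyclic P ->
  #|F| <= p ^ 4 * #|E| + p ^ 3 * (p ^ 3)`!.
Proof.
move=> freeF sEF nabE sylP ncP; have pP := pHall_pgroup sylP.
have sPF := pHall_sub sylP.
have nsPF := K33_free_noncyclic_Sylow_normal freeF sylP ncP.
have ntP : P :!=: 1 by apply: contraNneq ncP => ->; apply: cyclic1.
have [p_pr _ _] := pgroup_pdiv pP ntP.
have [P1 | ntPhi] := eqVneq 'Phi(P) 1.
  apply: leq_trans (leq_addl _ _).
  have leP : #|P| <= p ^ 3.
    by have := K33_free_Phi_index freeF sPF pP p_pr; rewrite P1 indexg1.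
  apply: leq_trans (card_norm_cent_fact (normal_norm nsPF)) _.
  apply: leq_mul; last exact: leq_fact.
  apply: leq_trans leP; apply: subset_leq_card.
  rewrite (sub_normal_Hall sylP nsPF) ?subsetIl //.
  apply: p_elements_pgroup => y Cy; exact: p'_cent_noncyclic freeF sPF pP ncP Cy.
apply: leq_trans (leq_addr _ _).
have pF : p.-group F.
  apply: p_elements_pgroup => y Fy p'y.
  apply: (p'_cent_noncyclic freeF sPF pP ncP) => //; rewrite inE Fy.
  exact: K33_free_p'_cent freeF nsPF pP ntPhi Fy p'y.
exact: K33_free_pgroup_bound freeF (subxx F) pF sEF nabE.
Qed.

(** The automorphisms induced on [S] form a subgroup of [Aut S], of order [p ^ (n - 1) (p - 1)]. A
    prime [q] dividing their number is not [p], since [S] centralises itself, and [q >= p] cannot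
    divide [p - 1]. *)
Lemma cyclic_pdiv_norm_cent (gT : finGroupType) (G S : {group gT}) (p : nat) :
  p = pdiv #|G| -> p.-Sylow(G) S -> cyclic S -> 'N_G(S) \subset 'C(S).
Proof.
move=> def_p sylS cS; have [sSG pS p'i] := and3P sylS.
have sSN : S \subset 'N_G(S) by rewrite subsetI sSG normG.
rewrite -indexg_eq1; apply: contraT => ne1.
set i := #|_ : _| in ne1; have i_gt0 : 0 < i := indexg_gt0 _ _.
have i_gt1 : 1 < i by rewrite ltn_neqAle eq_sym ne1.
pose q := pdiv i; have q_pr : prime q := pdiv_prime i_gt1.
have q_dvi : q %| i := pdiv_dvd _.
have i_dvG : i %| #|G|.
  apply: dvdn_trans (cardSg (subsetIl G 'N(S))).
  by rewrite /i -indexgI -(LagrangeI 'N_G(S) 'C(S)) dvdn_mull // indexgI.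
have G_gt1 : 1 < #|G| := leq_trans (prime_gt1 q_pr) (dvdn_leq (cardG_gt0 G) (dvdn_trans q_dvi i_dvG)).
have p_pr : prime p by rewrite def_p pdiv_prime.
have le_pq : p <= q by rewrite def_p pdiv_min_dvd ?prime_gt1 // (dvdn_trans q_dvi).
have ntS : S :!=: 1.
  apply/eqP=> S1; have := card_Hall sylS; rewrite S1 cards1 => /esym/eqP.
  by rewrite p_part_eq1 mem_primes p_pr cardG_gt0 def_p pdiv_dvd.
have p'q : q != p.
  apply: contraTneq q_dvi => ->; rewrite -p'natE //.
  apply: pnat_dvd (p'i); rewrite -(Lagrange_index (subsetIl G 'N(S)) sSN).
  apply: dvdn_mull; rewrite /i; apply: indexgS.
  exact: cyclic_abelian.
have i_dvA : i %| #|Aut S|.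
  have <- : #|conj_aut S @* 'N_G(S)| = i.
    by rewrite card_morphim ker_conj_aut (setIidPr (subsetIr _ _)).
  exact/cardSg/Aut_conj_aut.
rewrite card_Aut_cyclic // (card_pgroup pS) totient_pfactor // in i_dvA; last first.
  by have [_ p_dvS _] := pgroup_pdiv pS ntS; rewrite logn_gt0 mem_primes p_pr cardG_gt0.
have := dvdn_trans q_dvi i_dvA; rewrite Euclid_dvdM // => /orP[q_dvp1 | ].
  have p1_gt0 : 0 < p.-1 by rewrite -ltnS prednK ?prime_gt1 ?prime_gt0.
  have := dvdn_leq p1_gt0 q_dvp1; rewrite leqNgt => /negP[].
  by rewrite (leq_trans _ le_pq) // prednK ?prime_gt0.
by rewrite Euclid_dvdX // dvdn_prime2 // (negPf p'q).
Qed.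

Lemma Zgroup_cyclic_Sylow (gT : finGroupType) (G S : {group gT}) (p : nat) :
  Zgroup G -> p.-Sylow(G) S -> cyclic S.
Proof. by move=> /forall_inP ZG sylS; apply: ZG; apply: p_Sylow sylS. Qed.

Lemma Zgroup_pdiv_complement (gT : finGroupType) (G : {group gT}) :
  Zgroup G -> exists K : {group gT}, K <| G /\ (pdiv #|G|)^'.-Hall(G) K.
Proof.
move=> ZG; have [S sylS] := Sylow_exists (pdiv #|G|) G.
apply: (Burnside_normal_complement sylS).
exact: cyclic_pdiv_norm_cent (erefl _) sylS (Zgroup_cyclic_Sylow ZG sylS).
Qed.

Lemma Zgroup_solvable (gT : finGroupType) (G : {group gT}) : Zgroup G -> solvable G.
Proof.
have [n] := ubnP #|G|; elim: n => // n IHn in G * => /ltnSE-leGn ZG.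
have [-> | ntG] := eqVneq (gval G) 1; first exact: solvable1.
have [K [nsKG hallK]] := Zgroup_pdiv_complement ZG.
have p_pr : prime (pdiv #|G|) by rewrite pdiv_prime ?cardG_gt1.
have sKG := normal_sub nsKG; rewrite (series_sol nsKG); apply/andP; split.
  apply: IHn (ZgroupS sKG ZG); apply: leq_trans leGn.
  rewrite proper_card // properEneq sKG andbT; apply/eqP=> eK.
  have := pHall_pgroup hallK; rewrite /pgroup eK p'natE //.
  by rewrite pdiv_dvd.
apply: (@pgroup_sol _ (pdiv #|G|)); rewrite pgroupE card_quotient ?normal_norm //.
by have [_ _] := and3P hallK; rewrite pnatNK.
Qed.

(** Given four primes, solvability puts a Sylow [q 0]-subgroup [S] into Hall subgroups for [q 0] and
    each [r i]. The first steps of chains from [S] into these are three covers of [S], and the one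
    for [r i] has an element of order [r i]. *)
Lemma K33_free_solvable_primes (gT : finGroupType) (G : {group gT}) :
  K33_free G -> solvable G -> size (primes #|G|) <= 3.
Proof.
move=> freeG solG; rewrite leqNgt; apply/negP=> many.
pose q k := nth 0%N (primes #|G|) k.
have lt3 k : k < 4 -> k < size (primes #|G|) by move=> lt_k; apply: leq_trans many.
have q_mem k : k < 4 -> q k \in primes #|G| by move=> lt_k; rewrite mem_nth ?lt3.
have q_pr k : k < 4 -> prime (q k) by move/q_mem; rewrite mem_primes; case/andP.
have q_inj k l : k < 4 -> l < 4 -> (q k == q l) = (k == l).
  by move=> lt_k lt_l; rewrite nth_uniq ?lt3 ?primes_uniq.
pose r := triple (q 1%N) (q 2) (q 3).
have r_pr i : prime (r i) by case: i; apply: q_pr.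
have r_mem i : r i \in primes #|G| by case: i; apply: q_mem.
have r_q0 i : (r i == q 0) = false by case: i; rewrite q_inj.
have r_inj i j : r i = r j -> i = j.
  by case: i j => [] [] //= /eqP; rewrite q_inj.
have [S sylS] := Sylow_exists (q 0) G.
have [sSG pS _] := and3P sylS.
have ntS : S :!=: 1.
  rewrite -cardG_gt1 (card_Hall sylS) p_part_gt1; exact: q_mem.
have coverP i : exists N : {group gT},
    [/\ N \subset G, maximal S N & [pred x | (x == q 0) || (x == r i)].-group N].
  pose pi := [pred x | (x == q 0) || (x == r i)].
  have piS : pi.-group S by apply: sub_pgroup pS => x; rewrite !inE => ->.
  have [H hallH sSH] := Hall_superset solG sSG piS.
  have [||X [N [maxX sSX sNH sXS _]]] := @chain_step _ (fun X => X \subset S) S H sSH.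
  - exact: subxx.
  - move=> sHS; have pH : (q 0).-group H := pgroupS sHS pS.
    have : r i %| #|H|.
      have pir : pi.-nat (r i) by rewrite pnatE // !inE eqxx orbT.
      rewrite (card_Hall hallH) -(part_pnat_id pir) partn_dvd ?cardG_gt0 //.
      by have := r_mem i; rewrite mem_primes => /and3P[].
    by move/(pgroupP pH (r i) (r_pr i)); rewrite inE r_q0.
  have eX : X = S by apply/val_inj/eqP; rewrite eqEsubset sXS.
  exists N; split; first exact: subset_trans sNH (pHall_sub hallH).
    by rewrite -eX.
  exact: pgroupS sNH (pHall_pgroup hallH).
have [N NP] := choice _ coverP.
have rN i : exists x, x \in N i /\ #[x] = r i.
  have [_ maxS piN] := NP i.
  have r_dv : r i %| #|N i|.
    apply: contraT => ndv; have := maximal_ltn maxS; rewrite ltnNge.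
    have q0N : (q 0).-group (N i).
      apply/pgroupP=> p p_pr p_dv; have := pgroupP piN p p_pr p_dv.
      by rewrite !inE => /orP[//|/eqP ep]; rewrite -ep p_dv in ndv.
    rewrite (card_Hall sylS) dvdn_leq ?part_gt0 //.
    rewrite -(part_pnat_id q0N) partn_dvd ?cardG_gt0 // cardSg //.
    by have [] := NP i.
  by have [x Nx ox] := Cauchy (r_pr i) r_dv; exists x.
have [x xP] := choice _ rN.
have nr_dv (X : {group gT}) pi p : pi.-group X -> prime p -> p \notin pi -> ~~ (p %| #|X|).
  by move=> piX p_pr; apply: contra => /(pgroupP piX p p_pr).
apply: freeG; apply: (K33_three_covers (W := S) (N := N) (L := fun i => <[x i]>%G)) => //.
- by move=> i; have [] := NP i.
- by move=> i; have [] := NP i.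
- move=> i j eN; apply: r_inj; have [_ _ piN] := NP j.
  have [Nx ox] := xP i; rewrite eN in Nx.
  have := pgroupP piN (r i) (r_pr i); rewrite -{1}ox order_dvdG // => /(_ isT).
  by rewrite !inE r_q0 => /eqP.
- move=> i; have [Nx ox] := xP i; have [_ maxS _] := NP i.
  rewrite properEneq cycle_subG Nx andbT; apply: contraNneq ntS => eN.
  have := cardSg (maximal_sub maxS); rewrite -eN -orderE ox => dvS.
  apply: contraT => ntS; have [_ q0_dv _] := pgroup_pdiv pS ntS.
  by have := dvdn_trans q0_dv dvS; rewrite dvdn_prime2 ?q_pr // eq_sym r_q0.
- move=> i; have [_ ox] := xP i; rewrite cycle_subG; apply/negP=> Sx.
  have := order_dvdG Sx; rewrite ox; apply/negP.
  by apply: nr_dv pS (r_pr i) _; rewrite !inE r_q0.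
Qed.

Lemma cyclic_Phi_maximal (gT : finGroupType) (Q : {group gT}) (q : nat) :
  q.-group Q -> cyclic Q -> Q :!=: 1 -> #|Q : 'Phi(Q)| = q.
Proof.
move=> qQ cQ ntQ; have [q_pr _ _] := pgroup_pdiv qQ ntQ.
have nsPQ := Phi_normal Q; have abQ := Phi_quotient_abelem qQ.
have cQP : cyclic (Q / 'Phi(Q)) := quotient_cyclic _ cQ.
have qi : q.-nat #|Q : 'Phi(Q)|.
  by rewrite -card_quotient ?normal_norm // -pgroupE quotient_pgroup.
have [k ek] := p_natP qi; move: cQP; rewrite (abelem_cyclic abQ).
rewrite card_quotient ?normal_norm // ek pfactorK //.
case: k ek => [|[|k]] // ek _.
have := Phi_proper ntQ; rewrite properE => /andP[_ /negP[]].
by rewrite -indexg_eq1 ek.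
Qed.

(** Put [F = 'Phi(Q)], of index [q] in [Q], and [R = 'Phi(S)]. If [R] acts nontrivially, three
    conjugates of [F R] are maximal in [Q R]; the same conjugates of [F S] contain them properly,
    but by order not [Q R]. *)
Lemma K33_free_cyclic_action (gT : finGroupType) (G Q S : {group gT}) (p q : nat) :
  K33_free G -> Q \subset G -> S \subset G -> q.-group Q -> p.-group S -> p != q ->
  cyclic Q -> S \subset 'N(Q) -> 'Phi(S) \subset 'C(Q).
Proof.
move=> freeG sQG sSG qQ pS neq cQ nQS; apply: contraT => ncR.
pose R := 'Phi(S)%G; have sRS : R \subset S := Phi_sub S.
have pR := pgroupS sRS pS; have nQR := subset_trans sRS nQS.
have ntQ : Q :!=: 1.
  by apply: contraNneq ncR => ->; rewrite centsC sub1G.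
have ntS : S :!=: 1.
  apply: contraNneq ncR => S1; apply: subset_trans sRS _.
  by rewrite S1 sub1G.
have [q_pr _ _] := pgroup_pdiv qQ ntQ.
have co (H K : {group gT}) : q.-group H -> p.-group K -> coprime #|H| #|K|.
  move=> qH pK; apply: pnat_coprime qH _; apply: sub_pgroup pK => x.
  by rewrite !inE => /eqP->.
have [u [Qu inj_u]] := coprime_three_conjugates qQ nQR (co Q R qQ pR) ncR.
pose F := 'Phi(Q)%G; have sFQ : F \subset Q := Phi_sub Q.
have qF := pgroupS sFQ qQ.
have nFS : S \subset 'N(F) := char_norm_trans (Phi_char Q) nQS.
have nFR := subset_trans sRS nFS.
pose W := (Q <*> R)%G; pose M := (F <*> R)%G; pose B := (F <*> S)%G.
have oW : #|W| = (#|Q| * #|R|)%N by rewrite /= norm_joinEr // coprime_cardMg ?co.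
have oM : #|M| = (#|F| * #|R|)%N by rewrite /= norm_joinEr // coprime_cardMg ?co.
have oB : #|B| = (#|F| * #|S|)%N by rewrite /= norm_joinEr // coprime_cardMg ?co.
have sMW : M \subset W by rewrite genS // setSU.
have maxM : maximal M W.
  apply: p_index_maximal => //; rewrite -divgS // oW oM divnMr ?cardG_gt0 // divgS //.
  by rewrite (cyclic_Phi_maximal qQ).
have WJ i : W :^ u i = W by rewrite conjGid // (subsetP (joing_subl Q R)).
case: freeG; apply: (K33_three_maximals (W := W) (M := fun i => (M :^ u i)%G)
                                         (B := fun i => (B :^ u i)%G)).
- by rewrite join_subG sQG (subset_trans sRS).
- by move=> i; rewrite /= -(WJ i) maximalJ.
- by move=> i j /(congr1 val)/= /inj_u.
- move=> i; rewrite conj_subG ?(subsetP sQG) // join_subG sSG andbT.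
  exact: subset_trans sFQ sQG.
- move=> i; rewrite /= properJ properEcard genS ?setUS //= oM oB ltn_pmul2l ?cardG_gt0 //.
  exact: proper_card (Phi_proper ntS).
- move=> i; rewrite /= -(WJ i) conjSg; apply/negP=> /(subset_trans (joing_subl _ _))/cardSg.
  rewrite oB Gauss_dvdl ?co // => /(dvdn_leq (cardG_gt0 _)).
  by rewrite leqNgt (proper_card (Phi_proper ntQ)).
Qed.

(* In a Hall [{p, q}]-subgroup the Sylow subgroup for the larger prime is normal. *)
Lemma K33_free_Zgroup_Phi_cent (gT : finGroupType) (G S : {group gT}) (p : nat) :
  K33_free G -> Zgroup G -> p.-Sylow(G) S -> G \subset 'C('Phi(S)).
Proof.
move=> freeG ZG sylS; have [sSG pS _] := and3P sylS.
have [P1 | ntP] := eqVneq 'Phi(S) 1; first by rewrite P1 cents1.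
have sPS : 'Phi(S) \subset S := Phi_sub S.
have ntS : S :!=: 1 by apply: contraNneq ntP => S1; rewrite -subG1 -S1.
have [p_pr p_dvS _] := pgroup_pdiv pS ntS.
have cS := Zgroup_cyclic_Sylow ZG sylS.
(* By orders, one Sylow subgroup per prime inside the centraliser suffices, so that only two primes
   occur at a time. *)
suffices dvC : #|G| %| #|'C_G('Phi(S))|.
  have /eqP eC : 'C_G('Phi(S)) == G.
    by rewrite eqEcard subsetIl dvdn_leq ?cardG_gt0.
  by rewrite -eC subsetIr.
suffices sylC q : prime q -> q %| #|G| -> exists Q : {group gT}, q.-Sylow(G) Q /\ Q \subset 'C('Phi(S)).
  apply/dvdn_partP => [|q]; first exact: cardG_gt0.
  rewrite mem_primes => /and3P[q_pr _ q_dvG].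
  have [Q [sylQ cQ]] := sylC q q_pr q_dvG.
  by rewrite -(card_Hall sylQ) cardSg // subsetI (pHall_sub sylQ).
move=> q_pr q_dvG; have [-> | neq] := eqVneq q p.
  by exists S; split=> //; rewrite centsC; apply: subset_trans sPS (cyclic_abelian cS).
pose pi := [pred x | (x == p) || (x == q)].
have piS : pi.-group S by apply: sub_pgroup pS => x; rewrite !inE => ->.
have solG := Zgroup_solvable ZG.
have [H hallH sSH] := Hall_superset solG sSG piS.
have sHG := pHall_sub hallH; have freeH := K33_freeS sHG freeG.
have ZH := ZgroupS sHG ZG.
have sylSH : p.-Sylow(H) S := pHall_subl sSH sHG sylS.
have [Q sylQ] := Sylow_exists q H.
have sylQG : q.-Sylow(G) Q.
  by apply: subHall_Sylow hallH _ sylQ; rewrite !inE eqxx orbT.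
exists Q; split=> //; have [sQH qQ _] := and3P sylQ.
have p_dvH : p %| #|H| := dvdn_trans p_dvS (cardSg sSH).
have H_gt1 : 1 < #|H| := leq_trans (prime_gt1 p_pr) (dvdn_leq (cardG_gt0 H) p_dvH).
have [K [nsKH hallK]] := Zgroup_pdiv_complement ZH.
have sKH := normal_sub nsKH.
have : pdiv #|H| \in pi.
  exact: pgroupP (pHall_pgroup hallH) _ (pdiv_prime H_gt1) (pdiv_dvd _).
(* In [H] the normal complement belonging to the smaller prime [r] is a Sylow [s]-subgroup. *)
have comp (r s : nat) (R : {group gT}) : pdiv #|H| = r -> s != r ->
    (forall x, (x \in pi) = (x == r) || (x == s)) -> s.-Sylow(H) R -> R <| H.
  move=> er nsr pirs sylR; rewrite er in hallK.
  have sK : s.-group K.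
    apply/pgroupP=> x x_pr x_dv; have := pgroupP (pHall_pgroup hallK) x x_pr x_dv.
    have := pgroupP (pHall_pgroup hallH) x x_pr (dvdn_trans x_dv (cardSg sKH)).
    by rewrite pirs !inE => /orP[/eqP-> | //]; rewrite eqxx.
  have sylK : s.-Sylow(H) K.
    rewrite pHallE sKH (card_Hall hallK) /=; apply/eqP/eq_in_partn => x x_pi.
    have x_H := pgroupP (pHall_pgroup hallH) x; move: x_pi; rewrite mem_primes.
    case/and3P=> x_pr _ x_dv; have := x_H x_pr x_dv; rewrite pirs !inE.
    by case/orP=> /eqP->; rewrite ?eqxx ?(negPf nsr) // eq_sym (negPf nsr).
  have [x Hx ->] := Sylow_trans sylK sylR.
  by rewrite (normsP (normal_norm nsKH)).
(* If [q] is the smaller prime, [S] is normal in [H] and ['Phi(S)] is nontrivial, so [q]-elements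
   centralise [S]. Otherwise [Q] is normal, and [S] acts on a cyclic group. *)
rewrite !inE => /orP[/eqP e | /eqP e]; last first.
  have nsSH : S <| H.
    apply: (comp q p S e _ _ sylSH); first by rewrite eq_sym.
    by move=> x; rewrite !inE orbC.
  apply: subset_trans (centS sPS); apply/subsetP=> y Qy.
  apply: K33_free_p'_cent freeH nsSH pS ntP (subsetP sQH y Qy) _.
  apply: sub_p_elt (mem_p_elt qQ Qy) => x; rewrite !inE => /eqP->.
  exact: neq.
have nsQH : Q <| H by apply: (comp p q Q e neq _ sylQ) => x; rewrite !inE.
rewrite centsC; apply: (K33_free_cyclic_action freeH sQH sSH qQ pS) => //.
- by rewrite eq_sym.
- exact: Zgroup_cyclic_Sylow ZH sylQ.
- exact: subset_trans sSH (normal_norm nsQH).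
Qed.

(** Each cyclic Sylow subgroup [S] has order [p |'Phi(S)|], and ['Phi(S)] is central in [G], hence
    contained in [E]. *)
Theorem K33_free_Zgroup_bound (gT : finGroupType) (G E : {group gT}) :
  K33_free G -> Zgroup G -> E \subset G -> ~~ abelian E ->
  #|G| <= \prod_(p <- primes #|G|) (p * #|E|).
Proof.
move=> freeG ZG sEG nabE.
rewrite {1}(prod_prime_decomp (cardG_gt0 G)) prime_decompE big_map /=.
rewrite !big_seq; elim/big_ind2: _ => // [m1 m2 n1 n2 | p]; first exact: leq_mul.
rewrite mem_primes => /and3P[p_pr _ p_dvG].
have [S sylS] := Sylow_exists p G; rewrite -p_part -(card_Hall sylS).
have [sSG pS _] := and3P sylS; have cS := Zgroup_cyclic_Sylow ZG sylS.
have ntS : S :!=: 1.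
  by rewrite -cardG_gt1 (card_Hall sylS) p_part_gt1 mem_primes p_pr cardG_gt0.
rewrite -(Lagrange (Phi_sub S)) (cyclic_Phi_maximal pS cS ntS) mulnC leq_mul2l.
apply/orP; right; apply: subset_leq_card.
apply: subset_trans (K33_free_cent_nonabelian freeG sEG nabE).
rewrite subsetI (subset_trans (Phi_sub S) sSG) centsC.
exact: subset_trans sEG (K33_free_Zgroup_Phi_cent freeG ZG sylS).
Qed.

(** * Finite subgroups of an infinite group *)

(* [fingroup] shadows the name [Group] of the definitions. *)
Import Defs.
Close Scope R_scope.

(** Indexing by ordinals provides a finite type, to which the theory of finite groups applies.
    Closure is stated as mere existence; the operations are chosen from it afterwards. *)
Record finsub (G : Group) := Finsub {
  finsub_order : nat;
  fenum : 'I_finsub_order -> G;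
  fenum_inj : injective fenum;
  finsub1 : exists i, fenum i = gone G;
  finsubM : forall i j, exists k, fenum k = gmul G (fenum i) (fenum j);
  finsubV : forall i, exists k, fenum k = ginv G (fenum i)
}.

Definition elements_of (G : Group) (D : finsub G) : Type := 'I_(finsub_order D).

HB.instance Definition _ G (D : finsub G) := Finite.on (elements_of D).

Section FinsubGroup.

Variables (G : Group) (D : finsub G).
Implicit Types x y z : elements_of D.

Let value x : G := @fenum G D x.

Definition finsub_one : elements_of D :=
  proj1_sig (constructive_indefinite_description _ (finsub1 D)).

Definition finsub_mul x y : elements_of D :=
  proj1_sig (constructive_indefinite_description _ (finsubM x y)).

Definition finsub_inv x : elements_of D :=
  proj1_sig (constructive_indefinite_description _ (finsubV x)).

Lemma finsub_oneE : value finsub_one = gone G.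
Proof. exact: proj2_sig (constructive_indefinite_description _ (finsub1 D)). Qed.

Lemma finsub_mulE x y : value (finsub_mul x y) = gmul G (value x) (value y).
Proof. exact: proj2_sig (constructive_indefinite_description _ (finsubM x y)). Qed.

Lemma finsub_invE x : value (finsub_inv x) = ginv G (value x).
Proof. exact: proj2_sig (constructive_indefinite_description _ (finsubV x)). Qed.

Lemma finsub_mulA : associative finsub_mul.
Proof. by move=> x y z; apply: (@fenum_inj _ D); rewrite -!/(value _) !finsub_mulE gmulA. Qed.

Lemma finsub_mul1 : left_id finsub_one finsub_mul.
Proof. by move=> x; apply: (@fenum_inj _ D); rewrite -!/(value _) finsub_mulE finsub_oneE gmul1l. Qed.

Lemma finsub_mulV : left_inverse finsub_one finsub_inv finsub_mul.
Proof.
by move=> x; apply: (@fenum_inj _ D); rewrite -!/(value _) finsub_mulE finsub_invE finsub_oneE gmulVl.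
Qed.

End FinsubGroup.

HB.instance Definition _ G (D : finsub G) :=
  Finite_isGroup.Build (elements_of D) (@finsub_mulA G D) (@finsub_mul1 G D) (@finsub_mulV G D).

Section FinsubLattice.

Variables (G : Group) (D : finsub G).
Implicit Types (x y : elements_of D) (X Y : {group elements_of D}).

Definition value x : G := @fenum G D x.

Lemma value_inj : injective value. Proof. exact: fenum_inj. Qed.

Lemma value1 : value 1 = gone G. Proof. exact: finsub_oneE. Qed.

Lemma valueM x y : value (x * y) = gmul G (value x) (value y).
Proof. exact: finsub_mulE. Qed.

Lemma valueV x : value x^-1 = ginv G (value x).
Proof. exact: finsub_invE. Qed.

Definition value_set X : G -> Prop := fun g => exists x, x \in X /\ value x = g.

Lemma value_setP X x : value_set X (value x) <-> x \in X.
Proof. by split=> [[y [Xy /value_inj <-]] | Xx] //; exists x. Qed.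

Lemma value_set_subgroup X : is_subgroup G (value_set X).
Proof.
split; first by exists 1; rewrite value1.
split=> [_ _ [x [Xx <-]] [y [Xy <-]] | _ [x [Xx <-]]].
  by exists (x * y); rewrite groupM ?valueM.
by exists x^-1; rewrite groupV valueV.
Qed.

Lemma value_set_eq X Y : same_set G (value_set X) (value_set Y) <-> X = Y.
Proof.
split=> [eXY | -> //]; apply/val_inj/setP=> x.
by apply/idP/idP=> /value_setP/eXY/value_setP.
Qed.

Lemma value_set_maximal X Y :
  maximal X Y -> maximal_subgroup_of G (value_set X) (value_set Y).
Proof.
move=> maxX; split; first exact: value_set_subgroup.
split; first exact: value_set_subgroup.
split=> [|L [L1 [LM LV]] sXL sLY].
  split=> [_ [x [Xx <-]] | ].
    by apply/value_setP; apply: (subsetP (maximal_sub maxX)).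
  have /properP[_ [y Yy nXy]] := maxgroupp maxX.
  by exists (value y); split; [apply/value_setP | move/value_setP; apply/negP].
(* [L] is an arbitrary predicate on [G]. Lying below [value_set Y], it is the image of a finite set,
   with membership decided classically. *)
pose B := [set x | if excluded_middle_informative (L (value x)) then true else false].
have BP x : x \in B <-> L (value x).
  by rewrite inE; case: excluded_middle_informative.
have gB : group_set B.
  apply/group_setP; split; first by apply/BP; rewrite value1.
  by move=> x y /BP Lx /BP Ly; apply/BP; rewrite valueM; apply: LM.
pose H := fingroup.Group gB.
have sXH : X \subset H by apply/subsetP=> x Xx; apply/BP/sXL/value_setP.
have sHY : H \subset Y by apply/subsetP=> x /BP/sLY/value_setP.
have LH : same_set G L (value_set H).
  move=> g; split=> [Lg | [x [/BP Lx <-]] //].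
  by have [x [_ ex]] := sLY g Lg; exists x; split=> //; apply/BP; rewrite ex.
by case: (maximal_between maxX sXH sHY) => <-; [left | right].
Qed.

Lemma planar_K33_free : planar_group G -> K33_free [set: elements_of D]%G.
Proof.
move=> planarG [A [B [AB _]]].
apply: (K33_minor_not_planar (@cover_sym _) _ AB).
apply: (planar_graph_pullback (phi := value_set) _ _ _ planarG).
- exact: value_set_subgroup.
- exact: value_set_eq.
by move=> X Y [] /value_set_maximal; [left | right].
Qed.

End FinsubLattice.
Section Assembly.

Variable G : Group.
Implicit Types D : finsub G.

Definition finsub_le D1 D2 : Prop :=
  forall x : elements_of D1, exists y : elements_of D2, value y = value x.

Lemma finsub_le_trans D1 D2 D3 : finsub_le D1 D2 -> finsub_le D2 D3 -> finsub_le D1 D3.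
Proof. by move=> le12 le23 x; have [y <-] := le12 x; apply: le23. Qed.

Lemma finsub_embedding D1 D2 : finsub_le D1 D2 ->
  exists f : {morphism [set: elements_of D1] >-> elements_of D2},
    'injm f /\ forall x, value (f x) = value x.
Proof.
move=> le12; have [f fP] := choice _ le12.
have fM : {in [set: elements_of D1] &, {morph f : x y / x * y}}.
  by move=> x y _ _; apply: value_inj; rewrite valueM !fP valueM.
exists (Morphism fM); split=> //; apply/injmP=> x y _ _ /(congr1 (fun z => value z)) /=.
by rewrite !fP => /value_inj.
Qed.

Lemma finsub_card D : #|[set: elements_of D]| = finsub_order D.
Proof. by rewrite cardsT card_ord. Qed.

Lemma finite_enumeration (T : Type) (l : list T) (A : T -> Prop) :
  (forall x, A x -> In x l) ->
  exists n (e : 'I_n -> T), injective e /\ forall x, A x <-> exists i, e i = x.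
Proof.
elim: l A => [|a l IHl] A Al.
  exists 0%N, (fun i : 'I_0 => match notF (ltn_ord i) with end).
  by split=> [[] // | x]; split=> [/Al // | [[]]].
have [x [Ax nx] | n [e [inj_e eP]]] := IHl (fun x => A x /\ x <> a).
  by case: (Al x Ax) => // eax; case: nx.
have [Aa | nAa] := classic (A a); last first.
  exists n, e; split=> // x; rewrite -eP; split=> [Ax | [] //].
  by split=> // exa; apply: nAa; rewrite -exa.
have Ae i : A (e i) /\ e i <> a by apply/eP; exists i.
have nea i := proj2 (Ae i).
exists n.+1, (fun i => if unlift ord0 i is Some j then e j else a); split.
  move=> i j; case: unliftP => [i' ->|->]; case: unliftP => [j' ->|->] //.
  - by move/inj_e->.
  - by move/nea.
  by move/esym/nea.
move=> x; split=> [Ax | [i <-]].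
  have [-> | nxa] := classic (x = a).
    by exists ord0; case: unliftP => // j /esym/eqP; rewrite (negPf (neq_lift _ _)).
  have [i ei] : exists i, e i = x by apply/eP.
  by exists (lift ord0 i); rewrite liftK.
by case: unliftP => [j _|_] //; apply: proj1 (Ae j).
Qed.

Lemma generated_subgroup (S : G -> Prop) : is_subgroup G (generated G S).
Proof.
split; first by move=> H [H1 _] _.
split=> [x y Sx Sy H sgH SH | x Sx H sgH SH].
  by have [_ [HM _]] := sgH; apply: HM; [apply: Sx | apply: Sy].
by have [_ [_ HV]] := sgH; apply: HV; apply: Sx.
Qed.

Hypothesis lfG : locally_finite G.

Lemma finsub_exists (l : list G) :
  exists D, forall x, In x l -> exists y : elements_of D, value y = x.
Proof.
have [l' fin] := lfG l; have [n [e [inj_e eP]]] := finite_enumeration fin.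
have [K1 [KM KV]] := generated_subgroup (fun x : G => In x l).
have Ke i : generated G (fun x => In x l) (e i) by apply/(eP (e i)); exists i.
have D1 : exists i, e i = gone G by apply/(eP (gone G)).
have DM i j : exists k, e k = gmul G (e i) (e j) 
  by apply/(eP (gmul G (e i) (e j))); apply: KM; apply: Ke.
have DV i : exists k, e k = ginv G (e i) 
  by apply/(eP (ginv G (e i))); apply: KV; apply: Ke.
exists (Finsub inj_e D1 DM DV) => x lx.
have [i <-] : exists i, e i = x by apply/(eP x) => H _; apply.
by exists i.
Qed.

Definition values D : list G := map (fun x : elements_of D => value x) (enum {: elements_of D}).

Lemma in_values D (x : elements_of D) : In (value x) (values D).
Proof.
rewrite /values; have : x \in enum {: elements_of D} by rewrite mem_enum.
elim: (enum _) => //= y s IHs; rewrite inE => /predU1P[-> | /IHs]; by [left | right].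
Qed.

Lemma finsub_join D (l : list G) : exists D', finsub_le D D' /\
  forall x, In x l -> exists y : elements_of D', value y = x.
Proof.
have [D' D'P] := finsub_exists (values D ++ l)%list.
exists D'; split=> [x | x lx]; apply: D'P; apply: in_or_app; last by right.
by left; apply: in_values.
Qed.

Lemma finsub_join2 D1 D2 : exists D, finsub_le D1 D /\ finsub_le D2 D.
Proof.
have [D [le1 D2P]] := finsub_join D1 (values D2).
by exists D; split=> // x; apply: D2P; apply: in_values.
Qed.

Hypothesis infG : infinite_group G.

Lemma finsub_unbounded D n : exists D', finsub_le D D' /\ n <= finsub_order D'.
Proof.
elim: n => [|n [D' [leDD' le_n]]]; first by exists D; split=> // x; exists x.
have [x nx] : exists x, forall y : elements_of D', value y <> x.
  apply: NNPP => none; apply: infG; exists (values D') => x _.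
  apply: NNPP => nin; apply: none; exists x => y eyx; apply: nin.
  by rewrite -eyx; apply: in_values.
have [D2 [le2 /(_ x)[|y ey]]] := finsub_join D' [:: x]; first by left.
exists D2; split; first exact: finsub_le_trans leDD' le2.
have [f [injf fP]] := finsub_embedding le2.
apply: leq_ltn_trans le_n _; rewrite -!finsub_card -(card_injm injf (subxx _)).
apply/proper_card/properP; split; first exact: subsetT.
exists y => //; apply/morphimP=> -[z _ _ ez].
by apply: (nx z); rewrite -ey ez fP.
Qed.

Hypothesis planarG : planar_group G.

Lemma planar_infinite_abelian : abelian_group G.
Proof.
move=> x y; apply: NNPP => nxy.
have [D0 D0P] := finsub_exists [:: x; y].
have [x0 ex0] := D0P x (or_introl (erefl _)).
have [y0 ey0] := D0P y (or_intror (or_introl (erefl _))).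
have nab0 : ~~ abelian [set: elements_of D0].
  apply/negP=> /centsP/(_ x0 (in_setT _) y0 (in_setT _)) exy; apply: nxy.
  by rewrite -ex0 -ey0 -!valueM exy.
pose e := finsub_order D0.
have subE D : finsub_le D0 D -> exists E : {group elements_of D},
    ~~ abelian E /\ #|E| = e.
  case/finsub_embedding=> f [injf _]; exists (f @* [set: elements_of D0])%G.
  by rewrite /= injm_abelian // card_injm // finsub_card.
suffices [D1 [B bound]] : exists D1 B, forall D, finsub_le D1 D -> finsub_order D <= B.
  have [D [leD]] := finsub_unbounded D1 B.+1.
  by rewrite ltnNge bound.
have freeD D := planar_K33_free (D := D) planarG.
(* A noncyclic Sylow [p]-subgroup of one finite subgroup forces noncyclic ones, for the same [p], in
   all larger finite subgroups. If none ever occurs, all finite subgroups are Z-groups. *)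
have [[D' [p [S [sylS ncS]]]] | allZ] := classic (exists D' p (S : {group elements_of D'}),
    p.-Sylow([set: elements_of D']) S /\ ~~ cyclic S).
  have [D1 [le0 le']] := finsub_join2 D0 D'.
  exists D1, (p ^ 4 * e + p ^ 3 * (p ^ 3)`!) => D leD.
  have [E [nabE <-]] := subE D (finsub_le_trans le0 leD).
  have [f [injf _]] := finsub_embedding (finsub_le_trans le' leD).
  have pS : p.-group (f @* S) by rewrite morphim_pgroup // (pHall_pgroup sylS).
  have [P sylP sSP] := Sylow_superset (subsetT _) pS.
  rewrite -finsub_card; apply: K33_free_noncyclic_bound (freeD D) (subsetT E) nabE sylP _.
  apply: contra ncS => /(cyclicS sSP); by rewrite (injm_cyclic injf) ?subsetT.
have ZD D : Zgroup [set: elements_of D].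
  apply/forall_inP=> S /SylowP[p _ sylS]; apply: contraT => ncS.
  by case: allZ; exists D, p, S.
have primes3 D : size (primes (finsub_order D)) <= 3.
  by rewrite -finsub_card; apply: K33_free_solvable_primes (freeD D) (Zgroup_solvable (ZD D)).
(* At most three primes occur, so some [D1] attains the largest number of them; above [D1] no new
   prime appears, and the product over the primes is a constant bound. *)
have [D1 [le01 max1]] : exists D1, finsub_le D0 D1 /\
    forall D, finsub_le D1 D -> size (primes (finsub_order D)) <= size (primes (finsub_order D1)).
  apply: NNPP => none.
  have grow n : exists D, finsub_le D0 D /\ n <= size (primes (finsub_order D)).
    elim: n => [|n [D [leD le_n]]]; first by exists D0; split=> // z; exists z.
    apply: NNPP => nD; apply: none; exists D; split=> // D2 leD2.
    rewrite leqNgt; apply/negP=> lt; apply: nD; exists D2; split.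
      exact: finsub_le_trans leD leD2.
    exact: leq_ltn_trans le_n lt.
  have [D [_]] := grow 4; by rewrite ltnNge primes3.
exists D1, (\prod_(p <- primes (finsub_order D1)) (p * e))%N => D leD.
have [E [nabE oE]] := subE D (finsub_le_trans le01 leD).
have := K33_free_Zgroup_bound (freeD D) (ZD D) (subsetT E) nabE.
rewrite finsub_card oE => /leq_trans; apply.
rewrite leq_eqVlt; apply/orP; left; apply/eqP/perm_big.
rewrite perm_sym; apply: uniq_perm; rewrite ?primes_uniq // => p.
have [f [injf _]] := finsub_embedding leD.
have dvd : finsub_order D1 %| finsub_order D.
  by rewrite -!finsub_card -(card_injm injf (subxx _)) cardSg ?subsetT.
have D_gt0 : 0 < finsub_order D by rewrite -finsub_card cardG_gt0.
have sub : {subset primes (finsub_order D1) <= primes (finsub_order D)}.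
  move=> q; rewrite !mem_primes => /and3P[-> _ q_dv]; rewrite D_gt0.
  exact: dvdn_trans q_dv dvd.
by have [_ ->] := uniq_min_size (primes_uniq _) sub (max1 D leD).
Qed.

End Assembly.

Theorem theorem2p4 (G : Group) :
  infinite_group G -> locally_finite G -> planar_group G -> abelian_group G.
Proof. by move=> infG lfG planarG; apply: planar_infinite_abelian. Qed.
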